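(* Let $r\ge 2$ be an integer and let $x_m=F_r^m(x)$ for $m\ge 0$ (the $m$-fold iterate of $F_r$ applied to $x$). Then for every integer $n\ge 4$, $$x_{n-1}=\sum_{\beta\in\mathcal{F}(\mathcal{D}_n)} xyx^{-1}y^{-1}x\left(\prod_{i=1}^{c_{n-1}}\beta_{[i]}\right)x^{-1}.$$
   Context: $K=k(x,y)$ is the skew field of rational functions in the non-commutative variables $x,y$ (the free skew field) over a field $k$ containing $\mathbb{Q}$. $F_r$ is the automorphism of $K$ fixing $k$ pointwise with $F_r(x)=xyx^{-1}$, $F_r(y)=(1+y^r)x^{-1}$. For monomials $A_i\in K$, $\prod_{i=1}^m A_i$ denotes the ordered non-commutative product $A_1A_2\cdots A_m$. Fix an integer $r\ge 2$. The sequence $c_n$ is defined by $c_1=0$, $c_2=1$, $c_n=rc_{n-1}-c_{n-2}$. Maximal Dyck path. For $n\ge 4$ consider the rectangle with vertices $(0,0)$, $(0,c_{n-2})$, $(c_{n-1}-c_{n-2},c_{n-2})$, $(c_{n-1}-c_{n-2},0)$; the diagonal is the segment from $(0,0)$ to $(c_{n-1}-c_{n-2},c_{n-2})$. A Dyck path is a lattice path from $(0,0)$ to $(c_{n-1}-c_{n-2},c_{n-2})$ with unit NORTH or EAST steps that never goes above the diagonal. $\mathcal{D}_n$ is the maximal one: no subpath of any other Dyck path lies above it. It consists of $(w_0,\alpha_1,w_1,\dots,\alpha_{c_{n-1}},w_{c_{n-1}})$, where the $w_i$ are vertices, $w_0=(0,0)$, $w_{c_{n-1}}=(c_{n-1}-c_{n-2},c_{n-2})$,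 and $\alpha_i$ is the edge connecting $w_{i-1}$ to $w_i$. Let $v_0=(0,0)$ and, for $1\le j\le c_{n-2}$, let $v_j$ be the upper end point of the $j$-th vertical edge of $\mathcal{D}_n$. For $i<j$ let $s_{i,j}$ be the slope of the line through $v_i$ and $v_j$ (a vertical line has slope $+\infty$), and let $s=s_{0,c_{n-2}}$ be the slope of the diagonal. Colored subpaths. For $0\le i<k\le c_{n-2}$ define a subpath $\alpha(i,k)$ of $\mathcal{D}_n$: (1) if $s_{i,t}\le s$ for all $t$ with $i<t\le k$, then $\alpha(i,k)$ is the subpath from $v_i$ to $v_k$ and is called blue; (2) if $s_{i,t}>s$ for some $i<t\le k$, then: (2-a) if the smallest such $t$ is of the form $i+c_m-wc_{m-1}$ for some integers $3\le m\le n-1$ and $1\le w<r-1$, then $\alpha(i,k)$ is the subpath from $v_i$ to $v_k$ and is called green, more precisely $(m,w)$-green; (2-b) otherwise, $\alpha(i,k)$ is the subpath from the immediate predecessor vertex of $v_i$ on $\mathcal{D}_n$ to $v_k$ and is called red. Let $\mathcal{P}(\mathcal{D}_n)=\{\alpha(i,k)\mid 0\le i<k\le c_{n-2}\}\cup\{\alpha_1,\dots,\alpha_{c_{n-1}}\}$. The set $\mathcal{F}(\mathcal{D}_n)$ consists of all sets $\beta=\{\beta_1,\dots,\beta_t\}$ such that: $t\ge 0$ and $\beta_j\in\mathcal{P}(\mathcal{D}_n)$ for all $1\le j\le t$; if $j\ne j'$ then $\beta_j$ and $\beta_{j'}$ have no common edge; if $\beta_j=\alpha(i,k)$ and $\beta_{j'}=\alpha(i',k')$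 then $i\ne k'$ and $i'\ne k$; and if $\beta_j=\alpha(i,k)$ is $(m,w)$-green then at least one of the $c_{m-1}-wc_{m-2}$ edges of $\mathcal{D}_n$ immediately preceding $v_i$ is contained in some $\beta_{j'}$. Weights. An edge $\alpha_i$ is supported on $\beta$ if $\alpha_i\in\beta$ or $\alpha_i$ is contained in some blue, green or red subpath belonging to $\beta$. For $1\le i\le c_{n-1}$, $\beta_{[i]}$ is: $x^{-1}y^{r}$ if $\alpha_i$ is not supported on $\beta$ and is horizontal; $x^{-1}y^{r-1}$ if $\alpha_i$ is not supported on $\beta$ and is vertical; $x^{-1}y^{0}$ if $\alpha_i\in\beta$ and $\alpha_i$ is horizontal; $x^{-1}y^{-1}$ if $\alpha_i\in\beta$ and $\alpha_i$ is vertical; $x^{0}y^{0}$ if $\alpha_i$ is horizontal and contained in some $\alpha(j,k)\in\beta$; $x^{0}y^{-1}$ if $\alpha_i$ is vertical, $\alpha_{i-r+1}$ is horizontal, and both are contained in one $\alpha(j,k)\in\beta$; $x^{1}y^{-1}$ if $\alpha_i$ and $\alpha_{i-r+1}$ are vertical and both are contained in one $\alpha(j,k)\in\beta$; $x^{-1}y^{-1}$ if $\alpha_i$ is the first (vertical) edge of a red subpath $\alpha(j,k)\in\beta$. *)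

(* Defs.v *)
From mathcomp Require Import all_boot all_order all_algebra.
Set Implicit Arguments.
Unset Strict Implicit.
Unset Printing Implicit Defensive.
Import Order.TTheory GRing.Theory Num.Theory.
Local Open Scope ring_scope.

(* ---------- The free skew field k(x, y) ---------- *)

Definition skew_field (K : unitRingType) : Prop :=
  forall u : K, u != 0 -> u \is a GRing.unit.

(* A specialization of K to D (P. M. Cohn): a k-algebra morphism f to D,
   defined on a subalgebra S of K, such that every element of S outside the
   kernel has its inverse in S.  The values of f outside S are irrelevant. *)
Definition specialization (k : fieldType) (K D : unitAlgType k)
    (S : {pred K}) (f : K -> D) : Prop :=
  [/\ GRing.subalg_closed S,
      f 1 = 1,
      forall a : k, {in S &, forall u v, f (a *: u + v) = a *: f u + f v},
      {in S &, forall u v, f (u * v) = f u * f v}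
    & {in S, forall u, f u != 0 -> u^-1 \in S}].

(* K is the free skew field over k on x, y, i.e. the universal field of
   fractions of the free algebra k<x, y>: a skew field over k generated by x, y
   which specializes to every skew field over k with two chosen elements a, b,
   sending x to a and y to b.  That the free algebra embeds in K follows,
   because it embeds in some skew field. *)
Definition free_skew_field (k : fieldType) (K : unitAlgType k) (x y : K) : Prop :=
  [/\ skew_field K,
      (forall S : {pred K}, GRing.divalg_closed S -> x \in S -> y \in S ->
         forall u, u \in S)
    & forall (D : unitAlgType k) (a b : D), skew_field D ->
        exists (S : {pred K}) (f : K -> D),
          [/\ specialization S f, x \in S /\ y \in S, f x = a & f y = b]].

Definition is_Fr (k : fieldType) (K : unitAlgType k) (x y : K) (r : nat)
    (F : {rmorphism K -> K}) : Prop :=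
  [/\ bijective F,
      forall a : k, F a%:A = a%:A,
      F x = x * y * x^-1
    & F y = (1 + y ^+ r) * x^-1].

(* ---------- The sequence c_n ---------- *)

(* The value at 0 is junk.  For r >= 2 the sequence is nondecreasing from index
   1 on, so the truncated subtraction is the true one. *)
Fixpoint c (r n : nat) : nat :=
  if n is n1.+1 then
    if n1 is n2.+1 then
      if n2 is _.+1 then (r * c r n1 - c r n2)%N else 1%N
    else 0%N
  else 0%N.

(* ---------- Dyck paths ---------- *)

(* A lattice path from the origin is the sequence of its steps: true is NORTH
   (vertical edge), false is EAST (horizontal edge).  The edge alpha_l, for
   l >= 1, is the entry of index l - 1; edges are indexed from 0 below. *)
Definition vertex (D : seq bool) (p : nat) : nat * nat :=
  (count negb (take p D), count id (take p D)).

Definition vertices (D : seq bool) : seq (nat * nat) :=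
  [seq vertex D p | p <- iota 0 (size D).+1].

Definition dyck_path (a b : nat) (D : seq bool) : bool :=
  (vertex D (size D) == (a, b))
  && all (fun p => p.2 * a <= b * p.1)%N (vertices D).

Definition weakly_below (D' D : seq bool) : bool :=
  all (fun p => has (fun q => (q.1 == p.1) && (p.2 <= q.2)%N) (vertices D))
      (vertices D').

Definition maximal_dyck_path (a b : nat) (D : seq bool) : Prop :=
  dyck_path a b D /\ forall D', dyck_path a b D' -> weakly_below D' D.

Definition is_Dn (r n : nat) (D : seq bool) : Prop :=
  maximal_dyck_path (c r n.-1 - c r n.-2)%N (c r n.-2) D.

(* The number of edges before v_j: v_j is the first vertex at height j, which
   is the origin if j = 0 and the upper end of the j-th vertical edge if j > 0. *)
Definition vpos (D : seq bool) (j : nat) : nat :=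
  find (fun p => (vertex D p).2 == j) (iota 0 (size D).+1).

Definition v (D : seq bool) (j : nat) : nat * nat := vertex D (vpos D j).

(* ---------- Colored subpaths ---------- *)

(* None is the slope +oo of a vertical line. *)
Definition slope (p q : nat * nat) : option rat :=
  if p.1 == q.1 then None
  else Some ((q.2%:R - p.2%:R) / (q.1%:R - p.1%:R)).

Definition slope_gt (s1 s2 : option rat) : bool :=
  match s1, s2 with
  | _, None => false
  | None, Some _ => true
  | Some a, Some b => b < a
  end.

(* s_{i,t} > s *)
Definition steep (r n : nat) (D : seq bool) (i t : nat) : bool :=
  slope_gt (slope (v D i) (v D t)) (slope (v D 0) (v D (c r n.-2))).

(* The smallest t with i < t <= k and s_{i,t} > s, if any. *)
Definition first_steep (r n : nat) (D : seq bool) (i k : nat) : option nat :=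
  ohead [seq t <- iota i.+1 (k - i) | steep r n D i t].

Definition blue (r n : nat) (D : seq bool) (i k : nat) : bool :=
  first_steep r n D i k == None.

Definition mw_green (r n : nat) (D : seq bool) (m w i k : nat) : bool :=
  if first_steep r n D i k is Some t then
    [&& (3 <= m <= n.-1)%N, (1 <= w < r.-1)%N
      & (t + w * c r m.-1 == i + c r m)%N]
  else false.

Definition green (r n : nat) (D : seq bool) (i k : nat) : bool :=
  [exists m : 'I_n, exists w : 'I_r, mw_green r n D m w i k].

Definition red (r n : nat) (D : seq bool) (i k : nat) : bool :=
  ~~ blue r n D i k && ~~ green r n D i k.

(* The number of edges before the initial vertex of alpha(i,k). *)
Definition alpha_start (r n : nat) (D : seq bool) (i k : nat) : nat :=
  if red r n D i k then (vpos D i).-1 else vpos D i.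

Definition in_alpha (r n : nat) (D : seq bool) (i k l : nat) : bool :=
  (alpha_start r n D i k <= l < vpos D k)%N.

(* inl (i, k) stands for alpha(i,k) and inr l for the single edge of index l.
   Distinct labels in PD denote distinct subpaths: the alpha(i,k) have at least
   two edges and pairwise different end points. *)
Definition label (r n : nat) : finType :=
  ('I_(c r n.-2).+1 * 'I_(c r n.-2).+1 + 'I_(c r n.-1))%type.

Definition in_label (r n : nat) (D : seq bool) (p : label r n) (l : nat) : bool :=
  match p with
  | inl ik => in_alpha r n D ik.1 ik.2 l
  | inr e => l == e
  end.

Definition PD (r n : nat) : {set label r n} :=
  [set p : label r n | if p is inl ik then (ik.1 < ik.2)%N else true].

(* beta contains alpha(i,k) *)
Definition has_alpha (r n : nat) (beta : {set label r n})
    (ik : 'I_(c r n.-2).+1 * 'I_(c r n.-2).+1) : bool :=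
  (inl ik : label r n) \in beta.

Definition supported (r n : nat) (D : seq bool) (beta : {set label r n})
    (l : nat) : bool :=
  [exists p in beta, in_label D p l].

Definition FD (r n : nat) (D : seq bool) : {set {set label r n}} :=
  [set beta : {set label r n} |
    [&& beta \subset PD r n,
        [forall p in beta, forall q in beta, (p != q) ==>
           [forall l : 'I_(c r n.-1), ~~ (in_label D p l && in_label D q l)]],
        [forall ik, forall jl, has_alpha beta ik && has_alpha beta jl ==>
           (ik.1 != jl.2) && (jl.1 != ik.2)]
      & [forall ik, forall m : 'I_n, forall w : 'I_r,
           has_alpha beta ik && mw_green r n D m w ik.1 ik.2 ==>
           [exists l : 'I_(c r n.-1),
              (vpos D ik.1 - (c r m.-1 - w * c r m.-2) <= l < vpos D ik.1)%N
              && supported D beta l]]]].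

(* ---------- Weights ---------- *)

(* beta_[l + 1].  The edge alpha_{l+1-(r-1)} has index l - (r-1), and exists
   only if r-1 <= l.  A supported vertical edge not in beta falls into the last
   branch exactly when it is the first edge of a red subpath in beta. *)
Definition weight (k : fieldType) (K : unitAlgType k) (x y : K) (r n : nat)
    (D : seq bool) (beta : {set label r n}) (l : 'I_(c r n.-1)) : K :=
  let vertical := nth false D in
  if ~~ supported D beta l then
    if vertical l then x^-1 * y ^+ r.-1 else x^-1 * y ^+ r
  else if (inr l : label r n) \in beta then
    if vertical l then x^-1 * y^-1 else x^-1
  else if ~~ vertical l then 1
  else if [exists ik, [&& has_alpha beta ik, in_alpha r n D ik.1 ik.2 l,
             (r.-1 <= l)%N & in_alpha r n D ik.1 ik.2 (l - r.-1)]] then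
    if vertical (l - r.-1)%N then x * y^-1 else y^-1
  else x^-1 * y^-1.

(* Main.v *)
From HB Require Import structures.
Require Import Defs.
From mathcomp Require Import all_boot all_order all_algebra.
From mathcomp Require Import zify.
Set Implicit Arguments.
Unset Strict Implicit.
Unset Printing Implicit Defensive.
Import Order.TTheory GRing.Theory Num.Theory.

(** Put [q = 1 + y^r] and [h = x^-1 q].  Conjugation turns [F] into the
    automorphism [Phi] with [Phi x = y] and [Phi y = y h y^-1], and the formula
    says that [Phi] maps the sum of the weights for D_n to the sum for D_(n+1).

    The paths are self-similar: replacing each horizontal edge of D_n by r - 1
    horizontal edges and a vertical one, and each vertical edge by r - 2
    horizontal edges and a vertical one, gives D_(n+1).  So the edges of D_n are
    the vertical edges of D_(n+1), each closing a block of edges.  This map is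
    linear of determinant 1 on lattice vectors, hence it preserves the
    comparison of slopes with the diagonal.

    A collection beta of subpaths amounts to a pair (T, A): T is the set of its
    supported edges, A the set of vertical edges in its maximal runs, that is
    (v_i, v_k] for each alpha(i,k) in beta (lemmas [beta_of_beta],
    [beta_of_FD]).  The colors leave a single condition on (T, A): if A contains
    all vertical edges from v_i up to v_t, where t is the first index with
    s_(i,t) > s, then T meets a certain number of edges before v_i.  The green
    numbers c_(m-1) - w c_(m-2) are all of one kind: if the vertical edges from
    v_i to v_t are read as edges of D_(n-1), they count the vertical ones among
    them ([climb], [mw_green_rise]).  Red subpaths are the case t = i + 1, where
    this number is 1 and the edge required in T is the first edge of the red
    subpath.

    Fix the support T of beta, and read it as the set of vertical edges in the
    runs of some beta' for D_(n+1).  Up to factors common to both sides, the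
    images under [Phi] of the weights of all beta with support T carry a factor
    [p = q^-1 y^r] for each vertical edge in A and [1 - p = q^-1] for each other
    one in T, and the weights of all such beta' carry a factor [p] for each
    unsupported edge and [1 - p] for each single edge.  Without the conditions
    both sums are thus the same product.  The conditions on the two sides are
    indexed by the same vertices, the critical ones ([good_prev], [good_next]),
    and by inclusion-exclusion ([incl_excl]) it is enough to compare the products
    in which some of them are violated: at each such vertex d factors [p] stand
    after it on one side, d factors [p] before it on the other.  These d factors
    cross one by one, starting from the innermost: the word before the vertex
    mirrors the one after it ([palindrome]), so that the part of the product
    between the two copies of a factor collapses to [y^-1], which commutes with
    [p] ([nest], [critical_region]).  This proves [step_fixed], hence the
    recursion [path_sum_step]. *)

Local Arguments c : simpl never.

(** * Heights and rises of the maximal Dyck paths *)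

Section Heights.
Variable r : nat.
Hypothesis hr : 2 <= r.
Local Notation C := (c r).

Lemma c_mono m : C m.+1 < C m.+2.
Proof.
elim: m => [//|m IH].
have -> : C m.+3 = r * C m.+2 - C m.+1 by [].
have : 2 * C m.+2 <= r * C m.+2 by rewrite leq_mul2r hr orbT.
lia.
Qed.

Lemma c_gt0 m : 0 < C m.+2.
Proof. exact: leq_ltn_trans (leq0n _) (c_mono m). Qed.

Lemma c_rec m : C m.+3 + C m.+1 = r * C m.+2.
Proof.
have -> : C m.+3 = r * C m.+2 - C m.+1 by [].
rewrite subnK //; apply: leq_trans (ltnW (c_mono m)) _.
by rewrite leq_pmull //; lia.
Qed.

(** Consecutive vectors (c_(m+1), c_m) form a basis of the lattice; the
    substitution producing the next path has determinant 1. *)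
Lemma c_det m : C m.+2 * C m.+2 = C m.+1 * C m.+3 + 1.
Proof.
elim: m => [//|m IH].
have h1 := c_rec m; have h2 := c_rec m.+1.
have : C m.+3 * (C m.+3 + C m.+1) = C m.+2 * (C m.+4 + C m.+2).
  by rewrite h1 h2 mulnCA [C m.+2 * _]mulnCA [C m.+3 * _]mulnC.
by rewrite !mulnDr IH [C m.+3 * C m.+1]mulnC; lia.
Qed.

(** Level m stands for the path D_(m+2), which has [C m.+1] edges, [C m] of
    them vertical.  Among its first p edges [ht m p] are vertical; [depth m p]
    measures how far the vertex reached lies below the diagonal, in units in
    which all depths are integers.  The vertical edges of level m + 1
    correspond to the edges of level m, and [pos m j] is the number of edges
    of level m + 1 before its vertex v_j. *)
Definition ht m p := (p * C m) %/ C m.+1.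
Definition depth m p := (p * C m) %% C m.+1.
Definition vert m p := ht m p < ht m p.+1.
Definition pos m j := r * j - ht m j.

(** The first vertex after i above the line through i parallel to the
    diagonal.  If there is none the value exceeds [C m.+1], so that no set of
    edges contains the whole range from i to [rise m i]. *)
Definition rise m i :=
  i.+1 + find (fun t => depth m t < depth m i) (iota i.+1 (C m.+1 - i)).
Definition climb m i := ht m (rise m i) - ht m i.

Lemma ht_depth m p : p * C m = ht m p * C m.+1 + depth m p.
Proof. exact: divn_eq. Qed.

Lemma depth_lt m p : depth m.+1 p < C m.+2.
Proof. by rewrite ltn_mod c_gt0. Qed.

Lemma ht0 m : ht m 0 = 0.
Proof. by rewrite /ht mul0n div0n. Qed.

Lemma depth0 m : depth m 0 = 0.
Proof. by rewrite /depth mul0n mod0n. Qed.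

Lemma ht_end m : ht m.+1 (C m.+2) = C m.+1.
Proof. by rewrite /ht mulKn // c_gt0. Qed.

Lemma ht_homo m p q : p <= q -> ht m p <= ht m q.
Proof. by move=> pq; rewrite leq_div2r // leq_mul2r pq orbT. Qed.

(** A step raises the height by at most one because the slope is less than 1. *)
Lemma htS m p : ht m.+1 p.+1 = ht m.+1 p + vert m.+1 p.
Proof.
rewrite /vert; have := ht_homo m.+1 (leqnSn p).
have := ht_depth m.+1 p; have := ht_depth m.+1 p.+1; have := depth_lt m p; have := depth_lt m p.+1.
have := c_mono m; set a := ht _ p; set b := ht _ p.+1 => *.
suff : b <= a.+1 by lia.
rewrite leqNgt; apply/negP => H.
have : a.+2 * C m.+2 <= b * C m.+2 by rewrite leq_mul2r H orbT.
lia.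
Qed.

Lemma ht_le m p : ht m.+1 p <= p.
Proof. by elim: p => [|p IH]; rewrite ?ht0 // htS; case: vert; lia. Qed.

Lemma ht_lt m p : ht m.+1 p.+1 <= p.
Proof.
have := ht_depth m.+1 p.+1; have := c_mono m; set a := ht _ _ => h1 h2.
rewrite leqNgt; apply/negP => H.
have : p.+1 * C m.+2 <= a * C m.+2 by rewrite leq_mul2r H orbT.
have : p.+1 * C m.+1 < p.+1 * C m.+2 by rewrite ltn_pmul2l.
lia.
Qed.

(** This is the identity ceil(j c_(m+3) / c_(m+2)) = r j - floor(j c_(m+1) /
    c_(m+2)), a consequence of the recurrence of c.  It makes [pos] adjoint to
    the height, and is the source of the block structure. *)
Lemma ltn_pos m p j : j <= C m.+2 -> (p < pos m.+1 j) = (ht m.+2 p < j).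
Proof.
move=> hj; rewrite {1}/ht ltn_divLR ?c_gt0 // ltn_subRL ltnNge [RHS]ltnNge.
congr (~~ _); rewrite addnC -leq_subLR /ht leq_divRL ?c_gt0 // mulnBl leq_subLR.
have -> : r * j * C m.+2 = j * C m.+1 + j * C m.+3.
  by rewrite -mulnDr addnC c_rec mulnCA mulnA.
by rewrite addnC leq_add2r.
Qed.

Lemma pos_le m p j : j <= C m.+2 -> (pos m.+1 j <= p) = (j <= ht m.+2 p).
Proof. by move=> hj; rewrite leqNgt ltn_pos // -leqNgt. Qed.

Lemma pos0 m : pos m 0 = 0.
Proof. by rewrite /pos muln0. Qed.

Lemma pos_end m : pos m.+1 (C m.+2) = C m.+3.
Proof. by rewrite /pos ht_end -c_rec addnK. Qed.

Lemma ht_le_mul m j : ht m.+1 j <= r * j.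
Proof. by apply: leq_trans (ht_le m j) _; rewrite leq_pmull //; lia. Qed.

(** Block j has r edges if edge j of the previous level is horizontal, and r -
    1 if it is vertical. *)
Lemma posS m j : pos m.+1 j.+1 + vert m.+1 j = pos m.+1 j + r.
Proof.
rewrite /pos htS; have := ht_le_mul m j; have := ht_le_mul m j.+1; rewrite htS mulnS.
by lia.
Qed.

Lemma ltn_posS m j : pos m.+1 j < pos m.+1 j.+1.
Proof. by have := posS m j; case: vert; lia. Qed.

Lemma pos_homo m i j : i <= j -> pos m.+1 i <= pos m.+1 j.
Proof.
move=> /subnK<-; elim: (j - i) => [//|k IH].
by rewrite addSn; apply: leq_trans IH (ltnW (ltn_posS _ _)).
Qed.

Lemma pos_lt m i j : i < j -> pos m.+1 i < pos m.+1 j.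
Proof. by move=> ij; apply: leq_trans (ltn_posS m i) (pos_homo _ ij). Qed.

Lemma ltn_pos2 m i j : (pos m.+1 i < pos m.+1 j) = (i < j).
Proof.
case: (ltnP i j) => [/pos_lt->//|/(pos_homo m) ij].
by apply/negbTE; rewrite -leqNgt.
Qed.

Lemma leq_pos2 m i j : (pos m.+1 i <= pos m.+1 j) = (i <= j).
Proof. by rewrite leqNgt ltn_pos2 -leqNgt. Qed.

Lemma leq_idpos m j : j <= pos m.+1 j.
Proof. by elim: j => [//|j IH]; exact: leq_ltn_trans IH (ltn_posS m j). Qed.

Lemma blockP m l : l < C m.+3 ->
  [/\ ht m.+2 l < C m.+2, pos m.+1 (ht m.+2 l) <= l & l < pos m.+1 (ht m.+2 l).+1].
Proof.
move=> hl; have h : ht m.+2 l < C m.+2.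
  by rewrite -(ltn_pos _ (leqnn _)) pos_end.
by split; rewrite ?pos_le ?ltn_pos //; apply: ltnW.
Qed.

Lemma ht_block m j l : j < C m.+2 -> pos m.+1 j <= l < pos m.+1 j.+1 -> ht m.+2 l = j.
Proof.
move=> hj; rewrite ltn_pos // pos_le ?ltnS; last exact: ltnW.
by rewrite -eqn_leq => /eqP.
Qed.

Lemma ht_pos m j : j <= C m.+2 -> ht m.+2 (pos m.+1 j) = j.
Proof.
move=> hj; apply/eqP; rewrite eqn_leq -(pos_le _ hj) leqnn andbT.
rewrite leqNgt; apply/negP => h.
move: hj; rewrite leq_eqVlt => /orP[/eqP e|hj].
  by move: h; rewrite e pos_end ht_end ltnn.
by have := ltn_posS m j; rewrite ltn_pos // ltnS leqNgt h.
Qed.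

Lemma vert_block m l : l < C m.+3 -> vert m.+2 l = (l.+1 == pos m.+1 (ht m.+2 l).+1).
Proof.
move=> hl; have [h1 h2 h3] := blockP hl.
by rewrite /vert eqn_leq h3 /= pos_le.
Qed.

(** The substitution preserves depths, having determinant 1. *)
Lemma depth_pos m i : i <= C m.+2 -> depth m.+2 (pos m.+1 i) = depth m.+1 i.
Proof.
move=> hi; have := ht_depth m.+2 (pos m.+1 i); rewrite ht_pos //.
rewrite /pos; have := ht_depth m.+1 i; have := c_rec m; have := ht_le_mul m i.
rewrite mulnBl; set a := ht _ _; set b := depth _ _; set d := depth _ _ => h1 h2 h3 h4.
have : a * C m.+2 <= r * i * C m.+2 by rewrite leq_mul2r h1 orbT.
have : r * i * C m.+2 = i * C m.+3 + i * C m.+1 by rewrite -mulnDr h2 mulnCA mulnA.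
lia.
Qed.

Lemma depth_block m l : l < C m.+3 ->
  depth m.+2 l = depth m.+1 (ht m.+2 l) + (l - pos m.+1 (ht m.+2 l)) * C m.+2.
Proof.
move=> hl; have [h1 h2 h3] := blockP hl.
rewrite -(depth_pos (ltnW h1)).
have := ht_depth m.+2 l; have := ht_depth m.+2 (pos m.+1 (ht m.+2 l)).
rewrite ht_pos; last exact: ltnW.
move=> e1 e2; rewrite mulnBl.
have : pos m.+1 (ht m.+2 l) * C m.+2 <= l * C m.+2 by rewrite leq_mul2r h2 orbT.
move: e1 e2; set a := depth _ _; set b := depth _ _; lia.
Qed.

Lemma rise_gt m i : i < rise m i.
Proof. by rewrite /rise addSn ltnS leq_addr. Qed.

Lemma rise_before m i j : i < j -> j < rise m i -> j <= C m.+1 -> depth m i <= depth m j.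
Proof.
move=> ij jt jC; rewrite leqNgt.
have hf : j - i.+1 < find (fun t => depth m t < depth m i) (iota i.+1 (C m.+1 - i)).
  by rewrite -(ltn_add2l i.+1) subnKC.
have := before_find 0 hf; rewrite nth_iota; last by move: ij jC; clear; lia.
by rewrite subnKC // => ->.
Qed.

Lemma rise_spec m i : rise m i <= C m.+1 -> depth m (rise m i) < depth m i.
Proof.
move=> h; have iC : i < C m.+1 := leq_trans (rise_gt m i) h.
have hh : has (fun t => depth m t < depth m i) (iota i.+1 (C m.+1 - i)).
  rewrite has_find size_iota -(ltn_add2l i.+1); apply: leq_ltn_trans h _; lia.
have := nth_find 0 hh; rewrite nth_iota //.
by rewrite has_find size_iota in hh.
Qed.

Lemma rise_eq m i t : i < t -> t <= C m.+1 -> depth m t < depth m i ->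
  (forall j, i < j < t -> depth m i <= depth m j) -> rise m i = t.
Proof.
move=> it tC h hb; apply/eqP; rewrite eqn_leq; apply/andP; split.
  rewrite leqNgt; apply/negP => lt.
  by have := rise_before it lt tC; rewrite leqNgt h.
rewrite leqNgt; apply/negP => lt.
have := rise_spec (ltnW (leq_trans lt tC)).
by rewrite ltnNge hb // rise_gt.
Qed.

Lemma rise_none m i : i <= C m.+1 -> (forall j, i < j <= C m.+1 -> depth m i <= depth m j) ->
  C m.+1 < rise m i.
Proof.
move=> iC h; rewrite ltnNge; apply/negP => le.
by have := rise_spec le; rewrite ltnNge h // rise_gt.
Qed.

(** The substitution preserves the comparison of slopes, and between two
    vertices v_j the depth only increases along the horizontal edges. *)
Lemma rise_pos m i : rise m.+1 i <= C m.+2 ->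
  rise m.+2 (pos m.+1 i) = pos m.+1 (rise m.+1 i).
Proof.
move=> h; have it := rise_gt m.+1 i; have iC := leq_trans it h.
apply: rise_eq.
- exact: pos_lt.
- by rewrite -pos_end; apply: pos_homo.
- by rewrite !depth_pos ?rise_spec //; apply: ltnW.
move=> l /andP[l1 l2].
have lC : l < C m.+3 by rewrite -pos_end; apply: leq_trans l2 (pos_homo _ h).
rewrite depth_pos ?depth_block //; last exact: ltnW.
apply: leq_trans (leq_addr _ _).
have : i <= ht m.+2 l by rewrite -(pos_le _ (ltnW iC)) ltnW.
rewrite leq_eqVlt => /orP[/eqP<-//|lt].
have lt2 : ht m.+2 l < rise m.+1 i by rewrite -ltn_pos.
by apply: rise_before => //; apply: ltnW (leq_trans lt2 h).
Qed.

Lemma rise_pos_none m i : i <= C m.+2 -> C m.+2 < rise m.+1 i ->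
  C m.+3 < rise m.+2 (pos m.+1 i).
Proof.
move=> iC h; apply: rise_none.
  by rewrite -pos_end; apply: pos_homo.
move=> l /andP[l1 l2].
have bef j : i <= j <= C m.+2 -> depth m.+1 i <= depth m.+1 j.
  rewrite leq_eqVlt => /andP[/orP[/eqP<-//|lt] jC].
  by apply: rise_before => //; apply: leq_ltn_trans h.
have il : i <= ht m.+2 l by rewrite -pos_le //; apply: ltnW.
move: l2; rewrite leq_eqVlt => /orP[/eqP->|lC].
  by rewrite -pos_end !depth_pos // bef // iC leqnn.
rewrite depth_pos // depth_block //.
have [h1 _ _] := blockP lC.
by apply: leq_trans (leq_addr _ _); rewrite bef // il ltnW.
Qed.

(** Inside a block all edges up to the last one are horizontal, and the depth
    of v_(j+1) is less than that of any inner vertex of the block. *)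
Lemma rise_inside m j l : j < C m.+2 -> pos m.+1 j < l < pos m.+1 j.+1 ->
  rise m.+2 l = pos m.+1 j.+1.
Proof.
move=> hj /andP[l1 l2].
have eC : pos m.+1 j.+1 <= C m.+3 by rewrite -pos_end; apply: pos_homo.
have hl k : pos m.+1 j <= k < pos m.+1 j.+1 ->
   depth m.+2 k = depth m.+1 j + (k - pos m.+1 j) * C m.+2.
  move=> hk; rewrite depth_block ?(ht_block hj hk) //.
  by apply: leq_trans eC; case/andP: hk.
apply: rise_eq => //.
  rewrite depth_pos // hl ?(ltnW l1) //.
  have := depth_lt m j.+1 => h.
  have : 1 * C m.+2 <= (l - pos m.+1 j) * C m.+2 by rewrite leq_mul2r subn_gt0 l1 orbT.
  by lia.
move=> k /andP[k1 k2]; rewrite !hl ?l2 ?k2 ?(ltnW l1) ?(ltnW (ltn_trans l1 k1)) //.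
by rewrite leq_add2l leq_mul2r; lia.
Qed.

End Heights.

(** * The edges on both sides of a rise mirror each other *)

Section Palindromes.
Variable r : nat.
Hypothesis hr : 2 <= r.
Local Notation C := (c r).
Local Notation ht := (ht r).
Local Notation depth := (depth r).
Local Notation pos := (pos r).
Local Notation rise := (rise r).
Local Notation climb := (climb r).
Local Notation vert := (vert r).

(** A lattice point close to the origin and strictly above the slope [C1 / C2]
    stays above the larger slope [C3 / C4]: in the basis of consecutive
    vectors (see [c_det]) its offsets from the successive lines form a
    nondecreasing sequence satisfying the recurrence of c. *)
Lemma above_next (C1 C2 C3 C4 j f : nat) : C2 < C3 ->
  C3 + C1 = r * C2 -> C4 + C2 = r * C3 -> C2 * C2 = C1 * C3 + 1 ->
  j <= C2 -> j * C1 < f * C2 -> j * C3 < f * C4.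
Proof.
move=> h23 e1 e2 det jC lt.
pose D0 := (Posz f * Posz C2 - Posz j * Posz C1)%R.
pose D1 := (Posz f * Posz C3 - Posz j * Posz C2)%R.
have D0p : (1 <= D0)%R by rewrite /D0; lia.
have ej : (Posz j = Posz C3 * D0 - Posz C2 * D1)%R.
  rewrite /D0 /D1.
  have : j * (C2 * C2) = j * (C1 * C3 + 1) by rewrite det.
  lia.
have D1D0 : (D0 <= D1)%R.
  have h1 : (Posz C2 * D0 < Posz C3 * D0)%R by nia.
  have h2 : (Posz C2 * D0 < Posz C2 * (D1 + 1))%R by lia.
  nia.
have : (Posz f * Posz C4 - Posz j * Posz C3 = Posz r * D1 - D0)%R.
  rewrite /D0 /D1.
  have : f * (C4 + C2) = f * (r * C3) by rewrite e2.
  have : j * (C3 + C1) = j * (r * C2) by rewrite e1.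
  lia.
have : (2 * D1 <= Posz r * D1)%R by rewrite ler_wpM2r //; lia.
lia.
Qed.

(** If (j, f) is below the slope [C1 / C2], then applying one inverse step of
    the recurrence gives a point (j', f'), and (j - j', f - f') lies above
    that slope by [e].  The inequality on [e] bounds the offset of (j, f) from
    the slope [C3 / C4] from below. *)
Lemma below_next (C1 C2 C3 C4 j f : nat) : C1 < C2 -> C2 < C3 ->
  C3 + C1 = r * C2 -> C4 + C2 = r * C3 -> C2 * C2 = C1 * C3 + 1 ->
  0 < j -> f * C2 <= j * C1 ->
  exists f2 e, [/\ 0 < e, f2 * C2 = (j - f) * C1 + e & f * C4 + e <= j * C3].
Proof.
move=> h12 h23 e1 e2 det j0 le.
have fj : f < j by nia.
pose E0 := (Posz j * Posz C1 - Posz f * Posz C2)%R.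
pose E1 := (Posz j * Posz C2 - Posz f * Posz C3)%R.
have E0p : (0 <= E0)%R by rewrite /E0; lia.
have ej : (Posz j = Posz C2 * E1 - Posz C3 * E0)%R.
  rewrite /E0 /E1.
  have : j * (C2 * C2) = j * (C1 * C3 + 1) by rewrite det.
  lia.
have E01 : (E0 < E1)%R.
  have h1 : (Posz C2 * E0 <= Posz C3 * E0)%R by nia.
  have h2 : (Posz C2 * E0 < Posz C2 * E1)%R by lia.
  nia.
have e1' : f * (C3 + C1) = f * (r * C2) by rewrite e1.
have e2' : f * (C4 + C2) = f * (r * C3) by rewrite e2.
have e3' : j * (C3 + C1) = j * (r * C2) by rewrite e1.
have F2 : ((Posz j + Posz f - Posz r * Posz f) * Posz C2 =
   (Posz j - Posz f) * Posz C1 + (E1 - E0))%R.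
  rewrite /E0 /E1; lia.
have E2 : (Posz j * Posz C3 - Posz f * Posz C4 = Posz r * E1 - E0)%R.
  rewrite /E0 /E1; lia.
have h3 : (2 * E1 <= Posz r * E1)%R by rewrite ler_wpM2r //; lia.
have h4 : (0 <= Posz j + Posz f - Posz r * Posz f)%R.
  have h5 : (0 <= (Posz j - Posz f) * Posz C1)%R by rewrite mulr_ge0 //; lia.
  have : (0 < (Posz j + Posz f - Posz r * Posz f) * Posz C2)%R by rewrite F2; lia.
  by rewrite pmulr_lgt0 => [/ltW//|]; lia.
exists (absz (Posz j + Posz f - Posz r * Posz f)%R), (absz (E1 - E0)%R).
have a1 : Posz (absz (E1 - E0)%R) = (E1 - E0)%R by lia.
have a2 : Posz (absz (Posz j + Posz f - Posz r * Posz f)%R)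
  = (Posz j + Posz f - Posz r * Posz f)%R by lia.
split; [lia| |].
  apply/eqP; rewrite -eqz_nat PoszD !PoszM -subzn; last exact: ltnW.
  by rewrite a1 a2 F2.
by rewrite -lez_nat PoszD !PoszM a1; lia.
Qed.

Lemma c_lt m n : m < n -> C m.+1 < C n.+1.
Proof.
move=> /subnK<-; elim: (n - m.+1) => [|k IH]; first exact: c_mono.
by apply: ltn_trans IH (c_mono hr _).
Qed.

Lemma c_le m n : m <= n -> C m.+1 <= C n.+1.
Proof. by rewrite leq_eqVlt => /orP[/eqP->//|/c_lt/ltnW]. Qed.

Lemma before_rise m i j : i + j < rise m.+1 i -> i + j <= C m.+2 ->
  (ht m.+1 (i + j) - ht m.+1 i) * C m.+2 <= j * C m.+1 /\
  j * C m.+1 + depth m.+1 i < (ht m.+1 (i + j) - ht m.+1 i).+1 * C m.+2.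
Proof.
move=> lt le.
have gle : depth m.+1 i <= depth m.+1 (i + j).
  case: (posnP j) => [->|jp]; first by rewrite addn0.
  by apply: rise_before => //; rewrite -addn1 leq_add2l.
have := ht_depth r m.+1 i; have := ht_depth r m.+1 (i + j); have := depth_lt hr m (i + j).
have hh : ht m.+1 i <= ht m.+1 (i + j) by apply: ht_homo; apply: leq_addr.
have : ht m.+1 i * C m.+2 <= ht m.+1 (i + j) * C m.+2 by rewrite leq_mul2r hh orbT.
rewrite mulnDl mulSn mulnBl; lia.
Qed.

(** The lower bound is where the definition of [rise] enters for earlier
    vertices: a violation would give, by [below_next], a vertex before the
    rise that is already above the line through i. *)
Lemma step_bounds m i j : rise m.+1 i <= C m.+2 -> 0 < j -> i + j < rise m.+1 i ->
  (ht m.+1 (i + j) - ht m.+1 i) * C m.+4 + depth m.+1 i < j * C m.+3 /\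
  j * C m.+3 < (ht m.+1 (i + j) - ht m.+1 i).+1 * C m.+4.
Proof.
move=> tC j0 jt.
have ijC : i + j <= C m.+2 by apply: ltnW (leq_trans jt tC).
have [b1 b2] := before_rise jt ijC.
have [c1 c2 c3] := And3 (c_mono hr m) (c_mono hr m.+1) (c_det hr m).
split; last first.
  apply: above_next c2 (c_rec hr m) (c_rec hr m.+1) c3 _ _; first exact: leq_trans (leq_addl i j) ijC.
  by apply: leq_ltn_trans b2; apply: leq_addr.
(* If the offset were at most the depth of i, the point (j - f, f2) would
   witness a vertex above the line through i before the rise. *)
have [f2 [e [e0 ef le]]] := below_next c1 c2 (c_rec hr m) (c_rec hr m.+1) c3 j0 b1.
apply: leq_trans le; rewrite ltn_add2l ltnNge; apply/negP => eg.
have jf : i + (j - (ht m.+1 (i + j) - ht m.+1 i)) < rise m.+1 i by apply: leq_ltn_trans jt; rewrite leq_add2l leq_subr.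
have [] := before_rise jf (ltnW (leq_trans jf tC)).
set f0 := ht _ (i + (j - _)) - _ => l1 l2.
have : f2 * C m.+2 < f0.+1 * C m.+2 by rewrite ef; apply: leq_ltn_trans l2; rewrite leq_add2l.
have : f0 * C m.+2 < f2 * C m.+2 by rewrite ef; apply: leq_ltn_trans l1 _; rewrite -addn1 leq_add2l.
by rewrite !ltn_pmul2r ?c_gt0 //; lia.
Qed.

Lemma ht_uniq m p k : k * C m.+1 <= p * C m < k.+1 * C m.+1 -> ht m p = k.
Proof.
move=> /andP[h1 h2]; have C0 : 0 < C m.+1 by move: h1 h2; case: (C m.+1) => //; rewrite !muln0.
apply/eqP; rewrite eqn_leq -ltnS /ht ltn_divLR // h2 leq_divRL //.
Qed.

Lemma vert_rise m i : rise m.+1 i <= C m.+2 ->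
  ht m.+1 (rise m.+1 i) = (ht m.+1 (rise m.+1 i).-1).+1.
Proof.
move=> tC; have it := rise_gt r m.+1 i; have lt := rise_spec hr tC.
have e : (rise m.+1 i).-1.+1 = rise m.+1 i by apply: prednK; apply: leq_ltn_trans it.
rewrite -{1}e htS // /vert e; case: ltnP => [_|h]; first by rewrite addn1.
have hh : ht m.+1 (rise m.+1 i) = ht m.+1 (rise m.+1 i).-1.
  by apply/eqP; rewrite eqn_leq h ht_homo // -{2}e.
have gle : depth m.+1 i <= depth m.+1 (rise m.+1 i).-1.
  have : i <= (rise m.+1 i).-1 by rewrite -ltnS e.
  rewrite leq_eqVlt => /orP[/eqP<-//|lt2].
  by apply: rise_before => //; rewrite ?e // (leq_trans _ tC) // leq_pred.
have := ht_depth r m.+1 (rise m.+1 i); have := ht_depth r m.+1 (rise m.+1 i).-1.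
have e2 : rise m.+1 i * C m.+1 = C m.+1 + (rise m.+1 i).-1 * C m.+1 by rewrite -mulSn e.
by rewrite hh e2; move: lt gle; clear; lia.
Qed.

Section Palindrome.
Variables m i : nat.
Hypothesis tC : rise m.+1 i <= C m.+2.
Local Notation a := (pos m.+1 i).
Local Notation A := (pos m.+2 a).
Local Notation d := (rise m.+1 i - i).

Let it : i < rise m.+1 i. Proof. exact: rise_gt. Qed.
Let iC : i <= C m.+2. Proof. exact: leq_trans (ltnW it) tC. Qed.
Let aC : a <= C m.+3. Proof. by rewrite -pos_end //; apply: pos_homo. Qed.
Let eA : A * C m.+3 = a * C m.+4 + depth m.+1 i.
Proof. by rewrite (ht_depth r m.+3) ht_pos // !depth_pos. Qed.
Let gpos : 0 < depth m.+1 i. Proof. exact: leq_ltn_trans (leq0n _) (rise_spec hr tC). Qed.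
Let Agt0 : 0 < A.
Proof. by rewrite lt0n; apply/eqP => A0; move: eA gpos; rewrite A0; lia. Qed.

(** Otherwise the origin would be one of the vertices reached backwards from
    A, but its depth 0 violates the strict inequalities of [step_bounds]. *)
Lemma palindrome_fits : d <= A.
Proof.
rewrite leqNgt; apply/negP => Ad.
have iA : i + A < rise m.+1 i by rewrite -ltn_subRL.
have [] := step_bounds tC Agt0 iA; rewrite eA ltn_add2r => h1 h2.
have : a * C m.+4 < (ht m.+1 (i + A) - ht m.+1 i).+1 * C m.+4.
  by apply: leq_ltn_trans h2; apply: leq_addr.
by move: h1; rewrite !ltn_pmul2r ?c_gt0 //; lia.
Qed.

(** Going j edges backwards from the vertex A two levels up, one meets one
    vertical edge more than going j edges forward from i.  Hence the d edges
    before A, read backwards and without the first and the last one, agree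
    with the d edges after i, again without the first and the last one. *)
Lemma palindrome j : 0 < j < d -> ht m.+3 (A - j) + (ht m.+1 (i + j) - ht m.+1 i).+1 = a.
Proof.
move=> /andP[j0 jd]; have jA : j <= A by apply: leq_trans (ltnW jd) palindrome_fits.
have ij : i + j < rise m.+1 i by rewrite -ltn_subRL.
have [] := step_bounds tC j0 ij; set f := _ - _ => h1 h2.
have fa : f < a.
  rewrite -(ltn_pmul2r (c_gt0 hr m.+2)).
  have : j * C m.+3 <= A * C m.+3 by rewrite leq_mul2r jA orbT.
  by rewrite eA; lia.
suff -> : ht m.+3 (A - j) = a - f.+1 by rewrite subnK.
apply: ht_uniq; rewrite -subSn // subSS (mulnBl A) (mulnBl a) (mulnBl a) eA.
have : f.+1 * C m.+4 <= a * C m.+4 by rewrite leq_mul2r fa orbT.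
move: h1 h2; rewrite mulSn => h1 h2 h3.
by apply/andP; split; lia.
Qed.

Lemma climbE : climb m.+1 i = (ht m.+1 (rise m.+1 i).-1 - ht m.+1 i).+1.
Proof.
rewrite /climb vert_rise // subSn // ht_homo // -ltnS prednK //.
Qed.

(** The d-th edge backwards from A is horizontal for d > 1, while the d-th
    edge forward from i is vertical; this compensates the excess of one
    vertical edge in [palindrome]. *)
Lemma palindrome_end : ht m.+3 (A - d) + climb m.+1 i = a.
Proof.
have dA := palindrome_fits.
have up : ht m.+3 (A - d) + climb m.+1 i <= a.
  case: (posnP d.-1) => [d1|d1].
    have e : (rise m.+1 i).-1 = i by lia.
    rewrite climbE e subnn addn1 -ltn_pos //; lia.
  have := @palindrome d.-1; rewrite climbE.
  have -> : i + d.-1 = (rise m.+1 i).-1 by lia.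
  have : ht m.+3 (A - d) <= ht m.+3 (A - d.-1) by apply: ht_homo; lia.
  lia.
apply/eqP; rewrite eqn_leq up /= addnC -leq_subLR.
have Ca : climb m.+1 i <= a by apply: leq_trans up; apply: leq_addl.
rewrite leq_divRL ?c_gt0 // (mulnBl A) (mulnBl a) eA.
have key : d * C m.+3 < climb m.+1 i * C m.+4.
  apply: above_next (c_mono hr m.+1) (c_rec hr m) (c_rec hr m.+1) (c_det hr m) _ _.
    exact: leq_trans (leq_subr _ _) tC.
  have := ht_depth r m.+1 i; have := ht_depth r m.+1 (rise m.+1 i); have := rise_spec hr tC.
  have : ht m.+1 i <= ht m.+1 (rise m.+1 i) by apply: ht_homo; apply: ltnW.
  rewrite /climb !mulnBl => h.
  have : ht m.+1 i * C m.+2 <= ht m.+1 (rise m.+1 i) * C m.+2 by rewrite leq_mul2r h orbT.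
  set u := depth _ _; set v := depth _ _; lia.
have : climb m.+1 i * C m.+4 <= a * C m.+4 by rewrite leq_mul2r Ca orbT.
by lia.
Qed.

End Palindrome.

Lemma pos_sub m i j : i <= j ->
  pos m.+1 j - pos m.+1 i + (ht m.+1 j - ht m.+1 i) = r * (j - i).
Proof.
move=> ij; have := ht_homo r m.+1 ij; have := pos_homo hr m ij; move: (ht_le_mul hr m j) (ht_le_mul hr m i).
by rewrite /pos mulnBr; lia.
Qed.

(** The numbers c_m - w c_(m-1) arise from the substitution.  A vertex inside
    a block rises at the end of the block after r - w edges, one of them
    vertical; each application of the substitution moves the pair of numbers
    of edges and vertical edges one step along the recurrence of c. *)
Lemma rise_form m i : rise m.+1 i <= C m.+2 ->
  rise m.+1 i - i = 1 /\ climb m.+1 i = 1 \/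
  exists nu w, [/\ nu < m, 0 < w < r.-1, rise m.+1 i - i + w * C nu.+2 = C nu.+3
     & climb m.+1 i + w * C nu.+1 = C nu.+2].
Proof.
have [C1 C2 C3] : [/\ C 1 = 0, C 2 = 1 & C 3 = r] by rewrite /c muln1 subn0.
elim: m i => [|m IH] l tC.
  by have := rise_spec hr tC; rewrite /depth C1 !muln0 !mod0n.
have lt := rise_gt r m.+2 l; have lC : l < C m.+3 by apply: leq_trans tC.
have [jC j1 j2] := blockP hr lC; set j := ht m.+2 l in jC j1 j2.
move: j1; rewrite leq_eqVlt => /orP[/eqP el|j1].
  case: (leqP (rise m.+1 j) (C m.+2)) => tj; last first.
    by have := rise_pos_none hr (ltnW jC) tj; rewrite el ltnNge tC.
  have jt := rise_gt r m.+1 j.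
  have et : rise m.+2 l = pos m.+1 (rise m.+1 j) by rewrite -el rise_pos.
  have ed := pos_sub m (ltnW jt); rewrite -et el -/(climb m.+1 j) in ed.
  have ec : climb m.+2 l = rise m.+1 j - j by rewrite /climb et -el !ht_pos // ltnW.
  rewrite ec; case: (IH _ tj) => [[e1 e2]|[nu [w [hnu hw e1 e2]]]].
    move: ed; rewrite e1 e2 => ed.
    case: (ltnP 2 r) => r2; last first.
      have er : r = 2 by apply/eqP; rewrite eqn_leq r2 hr.
      have ed2 : rise m.+2 l - l + 1 = 2 by rewrite ed muln1.
      by left; split; rewrite ?e1 //; move: ed2; clear; rewrite addn1 => -[].
    right; exists 0, 1; rewrite C1 C2 C3; split => //; lia.
  right; exists nu.+1, w; split => //.
  have := c_rec hr nu.+1; have := c_rec hr nu.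
  have : r * (rise m.+1 j - j) + r * (w * C nu.+2) = r * C nu.+3 by rewrite -mulnDr e1.
  have : w * (C nu.+3 + C nu.+1) = r * (w * C nu.+2) by rewrite c_rec // mulnCA.
  lia.
have et : rise m.+2 l = pos m.+1 j.+1 by apply: rise_inside => //; rewrite j1 j2.
have ec : climb m.+2 l = 1 by rewrite /climb et ht_pos // -/j subSnn.
have pS := posS hr m j.
rewrite ec et; case: (ltnP 1 (pos m.+1 j.+1 - l)) => d1; last by left; lia.
by right; exists 0, (r - (pos m.+1 j.+1 - l)); rewrite C1 C2 C3; split => //; lia.
Qed.

(** The numbers d belonging to different nu lie in disjoint intervals, which
    makes the pair (nu, w) unique. *)
Lemma form_bounds nu w d : 0 < w < r.-1 -> d + w * C nu.+2 = C nu.+3 ->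
  C nu.+2 < d < C nu.+3.
Proof.
move=> /andP[w0 w1] e; have := c_rec hr nu; have := c_mono hr nu; have := c_gt0 hr nu => h1 h2 h3.
have : w.+2 * C nu.+2 <= r * C nu.+2 by rewrite leq_mul2r; lia.
have : 1 * C nu.+2 <= w * C nu.+2 by rewrite leq_mul2r; lia.
by rewrite !mulSn; lia.
Qed.

Lemma form_uniq nu nu2 w w2 d : 0 < w < r.-1 -> 0 < w2 < r.-1 ->
  d + w * C nu.+2 = C nu.+3 -> d + w2 * C nu2.+2 = C nu2.+3 -> nu = nu2 /\ w = w2.
Proof.
move=> hw hw2 e e2.
have [/andP[a1 a2] /andP[b1 b2]] := (form_bounds hw e, form_bounds hw2 e2).
have en : nu = nu2.
  case: (ltngtP nu nu2) => // lt; exfalso.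
    have : C nu.+3 <= C nu2.+2 by apply: (@c_le nu.+2 nu2.+1).
    by lia.
  have : C nu2.+3 <= C nu.+2 by apply: (@c_le nu2.+2 nu.+1).
  by lia.
split=> //; move: e2; rewrite -en -e => /addnI/eqP.
by rewrite eqn_pmul2r ?c_gt0 // => /eqP.
Qed.

End Palindromes.

(** * Pairs of edge sets encoding collections of subpaths *)

Section Selections.
Variable r : nat.
Hypothesis hr : 2 <= r.
Local Notation C := (c r).
Local Notation ht := (ht r).
Local Notation depth := (depth r).
Local Notation pos := (pos r).
Local Notation rise := (rise r).
Local Notation climb := (climb r).

Definition block_edges m j := index_iota (pos m j) (pos m j.+1).
Definition guard_edges m a := index_iota (pos m a - climb m a) (pos m a).

(** The condition on a pair (T, A), with T a set of edges of level m + 1 and A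
    a set of edges of level m, which encodes a collection of subpaths: T are
    the supported edges, A the vertical edges in runs.  The second part
    unifies the colors: for green subpaths it is the required supported edge,
    for red ones it says that the first edge of the subpath is supported, and
    for blue ones its premise fails. *)
Definition good m (T A : pred nat) : bool :=
  all (fun j => A j ==> all T (block_edges m j)) (iota 0 (C m.+1)) &&
  all (fun a => all A (index_iota a (rise m a)) ==> has T (guard_edges m a))
    (iota 0 (C m.+1)).

(** The edge of level m in whose block the guard edges of a begin. *)
Definition gap_start m a := ht m.+1 (pos m a - climb m a).

(** The vertices at which the second part of [good] for the next level is a
    real condition, when T is the set of vertical edges in runs there: its
    premise holds and T alone does not provide a supported edge. *)
Definition critical m (T : pred nat) : seq nat :=
  [seq a <- iota 0 (C m.+1) |
    all T (index_iota a (rise m a)) && ~~ has T (index_iota (gap_start m a) a)].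

Lemma all_rangeP (P : pred nat) s t : reflect (forall l, s <= l < t -> P l) (all P (index_iota s t)).
Proof.
by apply: (iffP allP) => H l; move: (H l); rewrite mem_index_iota.
Qed.

Lemma has_rangeP (P : pred nat) s t : reflect (exists2 l, s <= l < t & P l) (has P (index_iota s t)).
Proof.
apply: (iffP hasP) => -[l]; rewrite ?mem_index_iota => h1 h2; exists l => //.
by rewrite mem_index_iota.
Qed.

Lemma all0P (P : pred nat) n : reflect (forall l, l < n -> P l) (all P (iota 0 n)).
Proof. by apply: (iffP allP) => H l; move: (H l); rewrite mem_iota. Qed.

(** For a vertex v_i the guard edges on the next level cover just the blocks
    of the guard edges of v_i. *)
Lemma gap_start_top m i : rise m.+1 i <= C m.+2 ->
  gap_start m.+2 (pos m.+1 i) = pos m.+1 i - climb m.+1 i /\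
  climb m.+2 (pos m.+1 i) = rise m.+1 i - i.
Proof.
move=> tC; have it := rise_gt r m.+1 i; have iC := leq_trans (ltnW it) tC.
have ec : climb m.+2 (pos m.+1 i) = rise m.+1 i - i.
  by rewrite /climb (rise_pos hr tC) !ht_pos.
by split=> //; rewrite /gap_start ec; have := palindrome_end hr tC; lia.
Qed.

Lemma gap_start_inside m j l : j < C m.+2 -> pos m.+1 j < l < pos m.+1 j.+1 ->
  gap_start m.+2 l = l.-1 /\ climb m.+2 l = 1.
Proof.
move=> jC hl; have hj : pos m.+1 j <= l < pos m.+1 j.+1.
  by case/andP: hl => /ltnW-> ->.
have eC : pos m.+1 j.+1 <= C m.+3 by rewrite -(pos_end hr); apply: pos_homo.
have lC : l < C m.+3 by case/andP: hj => _ h; apply: leq_trans h eC.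
have ec : climb m.+2 l = 1.
  by rewrite /climb (rise_inside hr jC hl) ht_pos // (ht_block hr jC hj) subSnn.
split=> //; rewrite /gap_start ec subn1.
have l0 : 0 < l by case/andP: hl => h _; apply: leq_ltn_trans h.
have l1C : l.-1 < C m.+3 by apply: leq_ltn_trans lC; apply: leq_pred.
apply: (ht_block hr l1C); rewrite (prednK l0) prednK ?leqnn ?andbT.
  by rewrite -ltnS prednK ?pos_lt ?prednK //; apply: leq_ltn_trans (leq0n _) (pos_lt hr m.+1 l0).
by apply: leq_ltn_trans (leq0n _) (pos_lt hr m.+1 l0).
Qed.

Lemma gap_start_lt m a : a <= C m.+2 -> rise m.+1 a <= C m.+2 -> gap_start m.+1 a < a.
Proof.
move=> aC tC; have := vert_rise hr tC; have := rise_gt r m.+1 a => lt e.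
have c0 : 0 < climb m.+1 a by rewrite climbE.
rewrite /gap_start -ltn_pos // ltn_subrL c0 /=.
have g0 : 0 < depth m.+1 a by apply: leq_ltn_trans (leq0n _) (rise_spec hr tC).
case: (posnP a) => [a0|a0]; first by rewrite a0 depth0 in g0.
by apply: leq_ltn_trans (leq0n _) (pos_lt hr m a0).
Qed.

(** If T meets the gap before a, then the last edge of a block contained in T'
    is a guard edge of a.  So only the critical vertices give conditions on
    T'. *)
Lemma good_next m (T' T : pred nat) : (forall l, T l -> l < C m.+2) ->
  good m.+1 T' T =
  all (fun j => T j ==> all T' (block_edges m.+1 j)) (iota 0 (C m.+2)) &&
  all (fun a => has T' (guard_edges m.+1 a)) (critical m.+1 T).
Proof.
move=> hT; rewrite /good; apply: andb_id2l => hb.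
apply/all0P/allP => [H a|H a aC].
  rewrite mem_filter mem_iota /= add0n => /andP[/andP[h1 _] aC].
  by have := H _ aC; rewrite h1.
apply/implyP => h; case hg : (has T (index_iota (gap_start m.+1 a) a)); last first.
  by apply: H; rewrite mem_filter mem_iota /= h hg.
have [l /andP[l1 l2] Tl] := has_rangeP _ _ _ hg.
have lC := hT _ Tl.
have := all0P _ _ hb _ lC; rewrite Tl /= => /all_rangeP hl.
have pS := ltn_posS hr m l.
have p1 : (pos m.+1 l.+1).-1.+1 = pos m.+1 l.+1 by apply: prednK; apply: leq_ltn_trans pS.
apply/has_rangeP; exists (pos m.+1 l.+1).-1; last by apply: hl; rewrite p1 leqnn andbT -ltnS p1.
rewrite p1 (leq_pos2 hr) l2 andbT -ltnS p1 ltn_pos //.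
Qed.

(** The condition on blocks is absorbed in the conditions at critical
    vertices: a block that is partly outside T has an inner vertex where the
    last part inside T begins, and this vertex is critical. *)
Lemma good_prev m (T A : pred nat) :
  (forall l, T l -> l < C m.+3) -> (forall j, A j -> j < C m.+2) ->
  good m.+1 T A =
  all (fun j => A j ==> T (pos m.+1 j.+1).-1) (iota 0 (C m.+2)) &&
  all (fun a => ~~ all A (index_iota (ht m.+2 a) (ht m.+2 (rise m.+2 a)))) (critical m.+2 T).
Proof.
move=> hT hA; have lastS j : (pos m.+1 j.+1).-1.+1 = pos m.+1 j.+1.
  by apply: prednK; apply: leq_ltn_trans (ltn_posS hr m j).
apply/idP/idP.
  move=> /andP[/all0P h1 /all0P h2]; apply/andP; split.
    apply/all0P => j jC; apply/implyP => Aj; have := h1 _ jC; rewrite Aj /= => /all_rangeP; apply.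
    by rewrite lastS leqnn andbT -ltnS lastS; apply: ltn_posS.
  apply/allP => a; rewrite mem_filter mem_iota /= add0n => /andP[/andP[/all_rangeP h3 /has_rangeP h4] aC].
  apply/negP => /all_rangeP h5.
  have ta := rise_gt r m.+2 a.
  have tC : rise m.+2 a <= C m.+3.
    rewrite -(prednK (leq_ltn_trans (leq0n _) ta)); apply: hT; apply: h3.
    by rewrite -ltnS prednK ?leqnn ?andbT //; apply: leq_ltn_trans ta.
  have [jC j1 j2] := blockP hr aC; set j := ht m.+2 a in jC j1 j2 h5.
  move: j1; rewrite leq_eqVlt => /orP[/eqP ea|j1].
    case: (leqP (rise m.+1 j) (C m.+2)) => tj; last first.
      by have := rise_pos_none hr (ltnW jC) tj; rewrite ea ltnNge tC.
    have [g1 g2] := gap_start_top tj; rewrite ea in g1.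
    have := h2 _ jC.
    have -> : all A (index_iota j (rise m.+1 j)).
      by apply/all_rangeP => k hk; apply: h5; rewrite -ea (rise_pos hr tj) ht_pos.
    move=> /= /has_rangeP[l hl Tl]; case: h4; exists l => //.
    by rewrite g1 -ea.
  have hin : pos m.+1 j < a < pos m.+1 j.+1 by rewrite j1.
  have [g1 g2] := gap_start_inside jC hin.
  have Aj : A j.
    by apply: h5; rewrite leqnn (rise_inside hr jC) ?j1 //= ht_pos // ltnS.
  have := h1 _ jC; rewrite Aj /= => /all_rangeP h6.
  have a0 : 0 < a by apply: leq_ltn_trans j1.
  case: h4; exists a.-1; first by rewrite g1 leqnn /= prednK.
  apply: h6; apply/andP; split; first by rewrite -ltnS prednK.
  by rewrite prednK // ltnW.
move=> /andP[/all0P h1 /allP h2].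
have bl j : j < C m.+2 -> A j -> all T (block_edges m.+1 j).
  move=> jC Aj; apply: contraT => /allPn[l0]; rewrite mem_index_iota => hl0 nT.
  have := h1 _ jC; rewrite Aj /= => Tl.
  (* The vertex of block j from which on the block lies in T. *)
  pose P k := (pos m.+1 j <= k) && all T (index_iota k (pos m.+1 j.+1)).
  have exP : exists k, P k.
    exists (pos m.+1 j.+1).-1; rewrite /P -ltnS lastS ltn_posS //=.
    by apply/all_rangeP => k; rewrite -{2}lastS ltnS -eqn_leq => /eqP<-.
  have [k /andP[k1 /all_rangeP k2] kmin] := ex_minnP exP.
  have kl0 : l0 < k.
    rewrite ltnNge; apply: contra nT => kl; apply: k2; rewrite kl.
    by case/andP: hl0.
  have k0 : 0 < k by apply: leq_ltn_trans kl0.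
  have kle : k <= (pos m.+1 j.+1).-1.
    apply: kmin; rewrite /P -ltnS lastS ltn_posS //=.
    by apply/all_rangeP => k'; rewrite -{2}lastS ltnS -eqn_leq => /eqP<-.
  have kin : pos m.+1 j < k < pos m.+1 j.+1.
    rewrite -lastS ltnS kle andbT; apply: leq_ltn_trans kl0.
    by case/andP: hl0.
  have eC : pos m.+1 j.+1 <= C m.+3 by rewrite -(pos_end hr); apply: pos_homo.
  have kC : k < C m.+3 by case/andP: kin => _ h; apply: leq_trans h eC.
  have [g1 _] := gap_start_inside jC kin.
  have et := rise_inside hr jC kin.
  have hk : ht m.+2 k = j by apply: (ht_block hr jC); case/andP: kin => /ltnW-> ->.
  have := h2 k; rewrite mem_filter mem_iota /= add0n kC andbT et hk ht_pos //.
  have -> : all T (index_iota k (pos m.+1 j.+1)) by apply/all_rangeP.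
  have -> : has T (index_iota (gap_start m.+2 k) k) = false.
    apply/has_rangeP => -[l]; rewrite g1 -{2}(prednK k0) ltnS -eqn_leq => /eqP<- Tk.
    have := kmin k.-1; rewrite -ltnS (prednK k0) ltnn => H; apply: notF; apply: H.
    rewrite /P -ltnS (prednK k0); case/andP: (kin) => -> _ /=.
    apply/all_rangeP => l'; rewrite leq_eqVlt (prednK k0) => /andP[/orP[/eqP<-//|h] h'].
    by apply: k2; rewrite h h'.
  move=> /(_ isT) /allPn[j']; rewrite mem_index_iota ltnS -eqn_leq => /eqP<-.
  by rewrite Aj.
apply/andP; split; first by apply/all0P => j jC; apply/implyP; apply: bl.
apply/all0P => i iC; apply/implyP => /all_rangeP h3; apply: contraT => h4.
have it := rise_gt r m.+1 i.
have tC : rise m.+1 i <= C m.+2.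
  rewrite -(prednK (leq_ltn_trans (leq0n _) it)); apply: hA; apply: h3.
  by rewrite -ltnS prednK ?leqnn ?andbT //; apply: leq_ltn_trans it.
have [g1 g2] := gap_start_top tC.
have pC : pos m.+1 i < C m.+3 by rewrite -(pos_end hr) pos_lt.
have := h2 (pos m.+1 i); rewrite mem_filter mem_iota /= add0n pC andbT (rise_pos hr tC) g1 h4 andbT.
rewrite !ht_pos //; last exact: ltnW.
have -> : all A (index_iota i (rise m.+1 i)) by apply/all_rangeP.
apply; apply/all_rangeP => l /andP[l1 l2].
have lC : l < C m.+3 by apply: leq_trans l2 _; rewrite -(pos_end hr); apply: pos_homo.
have [jC j1 j2] := blockP hr lC.
have Aj : A (ht m.+2 l) by apply: h3; rewrite -(pos_le hr) ?(ltnW iC) // l1 -(ltn_pos hr).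
by have /all_rangeP := bl _ jC Aj; apply; rewrite j1.
Qed.

(** The range from a to its rise lies inside T and the gap before b outside. *)
Lemma critical_apart m (T : pred nat) a b : (forall l, T l -> l < C m.+2) ->
  a \in critical m.+1 T -> b \in critical m.+1 T -> a < b -> rise m.+1 a <= gap_start m.+1 b.
Proof.
move=> hT; rewrite !mem_filter !mem_iota /= !add0n.
move=> /andP[/andP[/all_rangeP a1 /has_rangeP a2] aC] /andP[/andP[/all_rangeP b1 /has_rangeP b2] bC] ab.
rewrite leqNgt; apply/negP => lt.
have bt := rise_gt r m.+1 b.
have tC : rise m.+1 b <= C m.+2.
  rewrite -(prednK (leq_ltn_trans (leq0n _) bt)); apply: hT; apply: b1.
  by rewrite -ltnS prednK ?leqnn ?andbT //; apply: leq_ltn_trans bt.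
have gb := gap_start_lt (ltnW bC) tC.
have at_ := rise_gt r m.+1 a.
apply: b2; exists (maxn a (gap_start m.+1 b)); first by rewrite leq_maxr gtn_max ab gb.
by apply: a1; rewrite leq_maxl gtn_max at_ lt.
Qed.

End Selections.

(** * Sums of ordered products over sets that avoid given subsets *)

Local Open Scope ring_scope.

Section SetsOfPositions.

Definition nset n (S : {set 'I_n}) : pred nat :=
  fun l => [exists i : 'I_n, (i \in S) && (i == l :> nat)].

Lemma nsetE n (S : {set 'I_n}) (i : 'I_n) : nset S i = (i \in S).
Proof.
apply/existsP/idP => [[j /andP[jS /eqP/val_inj<-//]]|iS].
by exists i; rewrite iS eqxx.
Qed.

Lemma nset_lt n (S : {set 'I_n}) l : nset S l -> (l < n)%N.
Proof. by case/existsP => i /andP[_ /eqP<-]. Qed.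

Lemma nsetC n (S : {set 'I_n}) l : (l < n)%N -> nset (~: S) l = ~~ nset S l.
Proof. by move=> h; rewrite -[l]/(val (Ordinal h)) !nsetE inE. Qed.

Definition forced n (P : pred nat) (S : {set 'I_n}) : bool :=
  all (fun i => P i ==> nset S i) (iota 0 n).

Variable K : nzRingType.
Implicit Type F : nat -> bool -> K.

Lemma prod_eq0 (f : nat -> K) n i : (i < n)%N -> f i = 0 -> \prod_(0 <= j < n) f j = 0.
Proof.
move=> lt f0; rewrite (big_cat_nat (n := i)) //; last exact: ltnW.
by rewrite (big_ltn lt) f0 /= mul0r mulr0.
Qed.

Lemma sum_sets n F :
  \sum_(S : {set 'I_n}) \prod_(0 <= i < n) F i (nset S i)
  = \prod_(0 <= i < n) (F i true + F i false).
Proof.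
rewrite big_mkord bigA_distr; apply: eq_big => [S|S _]; first by rewrite inE.
by rewrite big_mkord; apply: eq_bigr => i _; rewrite nsetE; case: ifP.
Qed.

Lemma sum_sets_forced n F (P : nat -> pred nat) B :
  \sum_(S : {set 'I_n} | all (fun c => forced (P c) S) B) \prod_(0 <= i < n) F i (nset S i)
  = \prod_(0 <= i < n)
      (if has (fun c => P c i) B then F i true else F i true + F i false).
Proof.
pose F' i b := if has (fun c => P c i) B && ~~ b then 0 else F i b.
transitivity (\sum_(S : {set 'I_n}) \prod_(0 <= i < n) F' i (nset S i)); last first.
  rewrite sum_sets; apply: eq_bigr => i _; rewrite /F' andbF andbT.
  by case: has; rewrite ?addr0.
rewrite big_mkcond; apply: eq_bigr => S _; case: ifPn => [/allP h|/allPn[c cB]].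
  apply: eq_big_nat => i /andP[_ ltn]; rewrite /F'; case: ifP => // /andP[/hasP[c cB Pc] nS].
  have /allP/(_ i) := h _ cB; rewrite mem_iota ltn => /(_ isT).
  by rewrite Pc (negbTE nS).
move=> /allPn[i]; rewrite mem_iota negb_imply => /= ltn /andP[Pc nS].
rewrite (@prod_eq0 _ _ i) // /F' nS andbT.
by have -> : has (fun c0 => P c0 i) B by apply/hasP; exists c.
Qed.

(** Inclusion-exclusion over the constraints, in the form of an induction: a
    sum with the constraint at c is the sum without it minus the sum where it
    is violated.  The hypothesis covers all lists of violated constraints, for
    which the sums factor. *)
Lemma incl_excl n1 n2 F1 F2 (P1 P2 : nat -> pred nat) (cs : seq nat) :
  (forall B : seq nat, {subset B <= cs} ->
     \prod_(0 <= i < n1)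
       (if has (fun c => P1 c i) B then F1 i true else F1 i true + F1 i false)
   = \prod_(0 <= i < n2)
       (if has (fun c => P2 c i) B then F2 i true else F2 i true + F2 i false)) ->
  \sum_(S : {set 'I_n1} | all (fun c => ~~ forced (P1 c) S) cs)
    \prod_(0 <= i < n1) F1 i (nset S i)
  = \sum_(S : {set 'I_n2} | all (fun c => ~~ forced (P2 c) S) cs)
    \prod_(0 <= i < n2) F2 i (nset S i).
Proof.
move=> H.
suff gen cs' B0 : {subset cs' <= cs} -> {subset B0 <= cs} ->
  \sum_(S : {set 'I_n1} | all (fun c => ~~ forced (P1 c) S) cs' && all (fun c => forced (P1 c) S) B0)
    \prod_(0 <= i < n1) F1 i (nset S i)
  = \sum_(S : {set 'I_n2} | all (fun c => ~~ forced (P2 c) S) cs' && all (fun c => forced (P2 c) S) B0)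
    \prod_(0 <= i < n2) F2 i (nset S i).
  have := gen cs [::] (fun _ => id) (fun _ => ltac:(done)).
  by under eq_bigl do rewrite andbT; under [X in _ = X]eq_bigl do rewrite andbT.
elim: cs' B0 => [|c cs' IH] B0 h1 h2; first by rewrite /= !sum_sets_forced H.
have h1' : {subset cs' <= cs} by move=> z hz; apply: h1; rewrite inE hz orbT.
have h2' : {subset c :: B0 <= cs}.
  by move=> z; rewrite inE => /orP[/eqP->|]; [apply: h1; rewrite mem_head|apply: h2].
have e1 := IH B0 h1' h2; have e2 := IH (c :: B0) h1' h2'.
have split n F (P : nat -> pred nat) :
  \sum_(S : {set 'I_n} | all (fun c => ~~ forced (P c) S) (c :: cs') && all (fun c => forced (P c) S) B0)
    \prod_(0 <= i < n) F i (nset S i)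
  = \sum_(S : {set 'I_n} | all (fun c => ~~ forced (P c) S) cs' && all (fun c => forced (P c) S) B0)
    \prod_(0 <= i < n) F i (nset S i)
  - \sum_(S : {set 'I_n} | all (fun c => ~~ forced (P c) S) cs' && all (fun c => forced (P c) S) (c :: B0))
    \prod_(0 <= i < n) F i (nset S i).
  rewrite [X in _ = X - _](bigID (fun S => forced (P c) S)) /= addrC.
  rewrite [X in _ = _ + X - _](eq_bigl (fun S : {set 'I_n} => all (fun c => ~~ forced (P c) S) cs'
     && (forced (P c) S && all (fun c => forced (P c) S) B0))) => [|S].
    rewrite addrK; apply: eq_bigl => S.
    by case: (forced _ S); rewrite /= ?andbF ?andbT.
  by case: (forced _ S); rewrite /= ?andbF ?andbT.
by rewrite !split IH // IH.
Qed.

End SetsOfPositions.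

(** * Edge weights and telescoping products *)

Lemma prod_blocks (K : nzRingType) (f : nat -> K) (p : nat -> nat) a b :
  (forall j, (p j <= p j.+1)%N) -> (a <= b)%N ->
  \prod_(p a <= l < p b) f l = \prod_(a <= j < b) \prod_(p j <= l < p j.+1) f l.
Proof.
move=> hp /subnK<-; elim: (b - a)%N => [|k IH]; first by rewrite !big_geq.
have le : (p a <= p (k + a))%N.
  by elim: k {IH} => [//|k IH]; apply: leq_trans IH (hp _).
by rewrite addSn big_nat_recr ?leq_addl //= -IH (big_cat_nat le (hp _)).
Qed.

Section Blocks.
Variable r : nat.
Hypothesis hr : (2 <= r)%N.
Local Notation C := (c r).
Local Notation ht := (ht r).
Local Notation pos := (pos r).
Local Notation vert := (vert r).

Lemma block_lastK m j : (pos m.+1 j.+1).-1.+1 = pos m.+1 j.+1.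
Proof. by apply: prednK; apply: leq_ltn_trans (ltn_posS hr m j). Qed.

Lemma block_last_ge m j : (pos m.+1 j <= (pos m.+1 j.+1).-1)%N.
Proof. by rewrite -ltnS block_lastK ltn_posS. Qed.

Lemma block_last_sub m j : ((pos m.+1 j.+1).-1 - pos m.+1 j = r - vert m.+1 j - 1)%N.
Proof. by have := posS hr m j; have := block_lastK m j; lia. Qed.

Lemma vert_in m j e : (j < C m.+2)%N -> (pos m.+1 j <= e < pos m.+1 j.+1)%N ->
  vert m.+2 e = (e == (pos m.+1 j.+1).-1).
Proof.
move=> jC he; have eC : (e < C m.+3)%N.
  by case/andP: he => _ h; apply: leq_trans h _; rewrite -(pos_end hr) pos_homo.
by rewrite vert_block // (ht_block hr jC he) -(block_lastK m j) eqSS.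
Qed.

Lemma vert_low m j e : (j < C m.+2)%N -> (pos m.+1 j <= e < (pos m.+1 j.+1).-1)%N ->
  vert m.+2 e = false /\ ht m.+2 e = j.
Proof.
move=> jC /andP[e1 e2].
have he : (pos m.+1 j <= e < pos m.+1 j.+1)%N.
  by rewrite e1 -(block_lastK m j) ltnS ltnW.
by rewrite (vert_in jC he) (ht_block hr jC he) (ltn_eqF e2).
Qed.

Lemma vert_last m j : (j < C m.+2)%N ->
  vert m.+2 (pos m.+1 j.+1).-1 /\ ht m.+2 (pos m.+1 j.+1).-1 = j.
Proof.
move=> jC; have he : (pos m.+1 j <= (pos m.+1 j.+1).-1 < pos m.+1 j.+1)%N.
  by rewrite block_last_ge block_lastK leqnn.
by rewrite (vert_in jC he) (ht_block hr jC he) eqxx.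
Qed.

Lemma block_recr (K : nzRingType) (f : nat -> K) m j :
  \prod_(pos m.+1 j <= e < pos m.+1 j.+1) f e
  = (\prod_(pos m.+1 j <= e < (pos m.+1 j.+1).-1) f e) * f (pos m.+1 j.+1).-1.
Proof. by rewrite -{1}(block_lastK m j) big_nat_recr //= block_last_ge. Qed.

End Blocks.

Section Weights.
Variables (r : nat) (K : unitRingType) (x y : K).
Hypothesis hr : (2 <= r)%N.
Hypotheses (ux : x \is a GRing.unit) (uy : y \is a GRing.unit).
Local Notation q := (1 + y ^+ r).
Hypothesis uq : q \is a GRing.unit.
Local Notation ht := (ht r).
Local Notation vert := (vert r).

(** The weights are x^-1 y^(r-e) for an unsupported edge and x^-1 y^(-e) for a
    single one, where e is 1 for a vertical edge and 0 for a horizontal one;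
    [wt_any] is their sum.  Inside a run a vertical edge has weight [rho v],
    where v tells whether it corresponds to a vertical edge of the previous
    level; horizontal ones have weight 1. *)
Definition wt_out (e : nat) : K := x^-1 * y ^+ r * y^-1 ^+ e.
Definition wt_single (e : nat) : K := x^-1 * y^-1 ^+ e.
Definition wt_any (e : nat) : K := x^-1 * q * y^-1 ^+ e.
Definition rho (v : nat) : K := x ^+ v * y^-1.

Definition edge_wt m (T A : pred nat) (l : nat) : K :=
  if ~~ T l then wt_out (vert m.+1 l)
  else if ~~ A (ht m.+1 l) then wt_single (vert m.+1 l)
  else if vert m.+1 l then rho (vert m (ht m.+1 l)) else 1.

Lemma out_single e : wt_out e + wt_single e = wt_any e.
Proof. by rewrite /wt_out /wt_single /wt_any mulrDr mulr1 mulrDl; apply: addrC. Qed.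

Lemma comm_q n : GRing.comm q (y^-1 ^+ n).
Proof.
apply: commrX; apply: commrV; apply/commr_sym/commrD; first exact: commr1.
exact: commrX.
Qed.

Lemma comm_qX n : GRing.comm q (y ^+ n).
Proof. apply: commrX; apply/commr_sym/commrD; [exact: commr1|exact: commrX]. Qed.

Lemma yVK m n : (m <= n)%N -> y ^+ n * y^-1 ^+ m = y ^+ (n - m).
Proof. by move=> mn; rewrite exprVn -{1}(subnK mn) exprD mulrK // unitrX. Qed.

(** The image of a block with s horizontal edges, all in T: [up_summed s] if
    the choice of its vertical edge is summed over, [up_forced s] with the
    factor p = q^-1 y^r if the edge is forced to lie in A. *)
Definition up_forced (s : nat) : K := y^-1 ^+ s * (q^-1 * y ^+ r) * rho 1.
Definition up_summed (s : nat) : K := y^-1 ^+ s * rho 1.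

(** The factor p commutes with powers of y, so it may be carried by either of
    the two outer factors when only powers of y stand between them. *)
Lemma any_up_forced e k s : wt_any e * y^-1 ^+ k * up_forced s = wt_out (e + k + s) * rho 1.
Proof.
have -> : wt_any e * y^-1 ^+ k * up_forced s = x^-1 * (q * y^-1 ^+ (e + k + s) * q^-1) * y ^+ r * rho 1.
  by rewrite /wt_any /up_forced !exprD !mulrA.
rewrite comm_q mulrK // /wt_out -(mulrA x^-1) -(mulrA x^-1 (y ^+ r)); congr (_ * _ * _).
exact/commrX/commr_sym/commrX/commrV.
Qed.

Lemma out_up_summed e k s : wt_out e * y^-1 ^+ k * up_summed s = wt_out (e + k + s) * rho 1.
Proof. by rewrite /up_summed /wt_out !exprD !mulrA. Qed.

Lemma out_r : wt_out r * rho 1 = y^-1.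
Proof. by rewrite /wt_out -(mulrA x^-1) yVK // subnn expr0 mulr1 /rho expr1 mulrA mulVr // mul1r. Qed.

Lemma mul_mid (a b c d : K) : a * b * (c * d) = a * (b * c) * d.
Proof. by rewrite !mulrA. Qed.

Section Nest.
Variables eps s : nat -> nat.
Let L d := \prod_(0 <= j < d) wt_any (eps (d - j.+1)).
Let R d := \prod_(0 <= j < d) up_forced (s j).
Let L' d := \prod_(0 <= j < d) wt_out (eps (d - j.+1)).
Let R' d := \prod_(0 <= j < d) up_summed (s j).

Let LS d : L d.+1 = wt_any (eps d) * L d.
Proof. by rewrite /L big_nat_recl //= subn1. Qed.
Let LS' d : L' d.+1 = wt_out (eps d) * L' d.
Proof. by rewrite /L' big_nat_recl //= subn1. Qed.
Let RS d : R d.+1 = R d * up_forced (s d). Proof. by rewrite /R big_nat_recr. Qed.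
Let RS' d : R' d.+1 = R' d * up_summed (s d). Proof. by rewrite /R' big_nat_recr. Qed.

(** Each layer wraps the product inside it, which has collapsed to y^-1, and
    collapses to y^-1 in turn because the exponents of y add up to zero. *)
Lemma nest d : (forall j, (j < d)%N -> (eps j + (0 < j) + s j = r)%N) ->
  L d * R d = y^-1 ^+ (0 < d)%N /\ L' d * R' d = y^-1 ^+ (0 < d)%N.
Proof.
elim: d => [|d IH] H; first by rewrite /L /L' /R /R' !big_geq // mulr1.
have [|i1 i2] := IH; first by move=> j jd; apply: H; apply: ltnW.
rewrite LS RS LS' RS' (mul_mid _ (L d)) (mul_mid _ (L' d)) i1 i2.
by rewrite any_up_forced out_up_summed H // out_r.
Qed.

(** For the outermost layer no collapse is needed. *)
Lemma nest_end d : (forall j, (j.+1 < d)%N -> (eps j + (0 < j) + s j = r)%N) ->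
  L d * R d = L' d * R' d.
Proof.
case: d => [|d] H; first by rewrite /L /L' /R /R' !big_geq.
have [|i1 i2] := @nest d; first by move=> j jd; apply: H.
rewrite LS RS LS' RS' (mul_mid _ (L d)) (mul_mid _ (L' d)) i1 i2.
by rewrite any_up_forced out_up_summed.
Qed.
End Nest.

End Weights.

(** * Moving forced factors across a critical region *)

(** The segments need not be given in advance: from every admissible cut it
    suffices to find an earlier one. *)
Lemma prod_cut (K : nzRingType) (f g : nat -> K) (cut : pred nat) n :
  (forall z, (0 < z <= n)%N -> cut z -> exists z0, [/\ (z0 < z)%N, cut z0 &
     \prod_(z0 <= e < z) f e = \prod_(z0 <= e < z) g e]) ->
  cut n -> \prod_(0 <= e < n) f e = \prod_(0 <= e < n) g e.
Proof.
move=> H; suff gen z : (z <= n)%N -> cut z ->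
    \prod_(0 <= e < z) f e = \prod_(0 <= e < z) g e by apply: gen.
elim/ltn_ind: z => z IH zn cz; case: (posnP z) => [->|z0]; first by rewrite !big_geq.
have [|w [wz cw ew]] := H z _ cz; first by rewrite z0.
rewrite !(big_cat_nat (leq0n w) (ltnW wz)) /= ew IH //.
exact: leq_trans (ltnW wz) zn.
Qed.

Section CriticalRegions.
Variables (r : nat) (K : unitRingType) (x y : K).
Hypothesis hr : (2 <= r)%N.
Hypotheses (ux : x \is a GRing.unit) (uy : y \is a GRing.unit).
Local Notation q := (1 + y ^+ r).
Hypothesis uq : q \is a GRing.unit.
Local Notation C := (c r).
Local Notation ht := (ht r).
Local Notation pos := (pos r).
Local Notation vert := (vert r).
Local Notation rise := (rise r).
Local Notation climb := (climb r).
Local Notation critical := (critical r).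
Local Notation wt_out := (wt_out r x y).
Local Notation wt_any := (wt_any r x y).
Local Notation rho := (rho x y).
Local Notation up_forced := (up_forced r x y).
Local Notation up_summed := (up_summed x y).

(** The factor of an edge in T: with p when it is a vertical edge forced to
    lie in A. *)
Definition chosen_rho (b : bool) (v : bool) : K :=
  if b && v then q^-1 * y ^+ r * rho 1 else rho v.

Lemma prod_chosen_rho b m j l : (j < C m.+2)%N -> (pos m.+1 j <= l <= (pos m.+1 j.+1).-1)%N ->
  \prod_(l <= e < pos m.+1 j.+1) chosen_rho b (vert m.+2 e)
  = (if b then up_forced else up_summed) ((pos m.+1 j.+1).-1 - l)%N.
Proof.
move=> jC /andP[l1 l2]; rewrite -{1}(block_lastK hr m j) big_nat_recr //=.
have [-> _] := vert_last hr jC.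
rewrite (eq_big_nat _ _ (F2 := fun=> y^-1)) => [|e /andP[e1 e2]].
  rewrite prodr_const_nat /chosen_rho andbT /up_forced /up_summed.
  by case: b; rewrite ?mulrA.
have [|-> _] := @vert_low r hr m j e jC; first by rewrite e2 (leq_trans l1).
by rewrite /chosen_rho andbF /rho expr0 mul1r.
Qed.

(** This is the exchange of the d factors p between the guard edges of a and
    the edges from a to its rise.  For a vertex v_i the hypotheses of
    [nest_end] are those of [palindrome]; for an inner vertex of a block d is
    1. *)
Lemma critical_region m a : (a < C m.+3)%N -> (rise m.+2 a <= C m.+3)%N ->
  (\prod_(pos m.+2 a - climb m.+2 a <= e < pos m.+2 a) wt_any (vert m.+3 e))
    * (\prod_(a <= l < rise m.+2 a) chosen_rho true (vert m.+2 l))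
  = (\prod_(pos m.+2 a - climb m.+2 a <= e < pos m.+2 a) wt_out (vert m.+3 e))
    * (\prod_(a <= l < rise m.+2 a) chosen_rho false (vert m.+2 l)).
Proof.
move=> aC tC; have [jC j1 j2] := blockP hr aC; set j := ht m.+2 a in jC j1 j2.
move: j1; rewrite leq_eqVlt => /orP[/eqP ea|j1]; last first.
  have hin : (pos m.+1 j < a < pos m.+1 j.+1)%N by rewrite j1.
  have [_ ->] := gap_start_inside hr jC hin.
  rewrite (rise_inside hr jC hin) !prod_chosen_rho ?(ltnW j1) //=; last first.
  - by rewrite -ltnS block_lastK.
  - by rewrite -ltnS block_lastK.
  have a0 : (0 < pos m.+2 a)%N.
    by apply: leq_trans (leq_idpos hr m.+1 a); apply: leq_ltn_trans j1.
  rewrite -{2 4}(prednK a0) subn1 !big_nat1.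
  by have := any_up_forced x uq (vert m.+3 (pos m.+2 a).-1) 0; rewrite expr0 mulr1 => ->;
     have := out_up_summed r x y (vert m.+3 (pos m.+2 a).-1) 0; rewrite expr0 mulr1 => ->.
case: (leqP (rise m.+1 j) (C m.+2)) => tj; last first.
  by have := rise_pos_none hr (ltnW jC) tj; rewrite ea ltnNge tC.
have jt := rise_gt r m.+1 j.
have [_ ec] := gap_start_top hr tj; rewrite ea in ec; rewrite ec.
have et := rise_pos hr tj; rewrite ea in et; rewrite et.
set d := (rise m.+1 j - j)%N.
have dA : (d <= pos m.+2 a)%N by rewrite -ea; apply: palindrome_fits.
pose s k := (r - vert m.+1 (j + k) - 1)%N.
pose eps k := vert m.+3 (pos m.+2 a - k.+1)%N : nat.
have R b : \prod_(a <= l < pos m.+1 (rise m.+1 j)) chosen_rho b (vert m.+2 l)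
    = \prod_(0 <= k < d) (if b then up_forced else up_summed) (s k).
  rewrite -{1}ea (prod_blocks _ (p := pos m.+1)) => [|k|]; last exact: ltnW.
    rewrite -{1}(add0n j) big_addn; apply: eq_big_nat => k /andP[_ kd].
    have kC : (k + j < C m.+2)%N.
      by apply: leq_trans tj; rewrite addnC -ltn_subRL.
    by rewrite prod_chosen_rho // ?leqnn ?block_last_ge // block_last_sub // addnC.
  exact/ltnW/ltn_posS.
have L (f : nat -> K) : \prod_(pos m.+2 a - d <= e < pos m.+2 a) f (vert m.+3 e)
    = \prod_(0 <= k < d) f (eps (d - k.+1)%N).
  rewrite -{1}(add0n (pos m.+2 a - d)%N) big_addn subKn //.
  apply: eq_big_nat => k /andP[_ kd]; rewrite /eps; congr (f (vert _ _)).
  by lia.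
rewrite !R !(L wt_any) !(L wt_out); apply: nest_end => // k kd.
have e1 := htS hr m (j + k); rewrite -addnS in e1.
have jk : (k.+1 < d)%N by [].
have kA : (pos m.+2 a - k.+1).+1 = (pos m.+2 a - k)%N by lia.
have e2 := htS hr m.+2 (pos m.+2 a - k.+1); rewrite kA in e2.
have := palindrome hr tj (j := k.+1); rewrite ea => /(_ kd) p1.
have h1 := ht_homo r m.+1 (leq_addr k j).
rewrite /eps /s; case: (posnP k) => [k0|k0].
  move: e1 e2 p1; rewrite k0 subn0 addn0 addn1 ht_pos ?(ltnW aC) //.
  by case: vert; case: vert; lia.
have := palindrome hr tj (j := k); rewrite ea k0 (ltnW kd) => /(_ isT) p0.
have : (vert m.+1 (j + k) <= 1)%N by case: vert.
lia.
Qed.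

Lemma prod_block_T m (f : nat -> K) l (v : K) : (l < C m.+2)%N ->
  (forall e, (pos m.+1 l <= e < (pos m.+1 l.+1).-1)%N -> f e = 1) ->
  f (pos m.+1 l.+1).-1 = v -> \prod_(pos m.+1 l <= e < pos m.+1 l.+1) f e = v.
Proof.
move=> lC h1 h2; rewrite block_recr // (eq_big_nat _ _ (F2 := fun=> 1)) //.
by rewrite big1 // mul1r.
Qed.

Section Fixed.
Variables (m : nat) (T : pred nat).
Hypothesis hT : forall l, T l -> (l < C m.+3)%N.
Variable B : seq nat.
Hypothesis hB : {subset B <= critical m.+2 T}.

Definition spanned (j : nat) : bool :=
  has (fun a => ht m.+2 a <= j < ht m.+2 (rise m.+2 a))%N B.
Definition guarded (e : nat) : bool :=
  has (fun a => pos m.+2 a - climb m.+2 a <= e < pos m.+2 a)%N B.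

(** Factors of the two products to be compared, both written over the edges of
    the next level.  On the left the forced choices put a factor p on vertical
    edges of T, on the right they make guard edges unsupported. *)
Definition left_edge (e : nat) : K :=
  if T (ht m.+3 e) then
    if vert m.+3 e then chosen_rho (spanned (ht m.+2 (ht m.+3 e))) (vert m.+2 (ht m.+3 e)) else 1
  else wt_any (vert m.+3 e).

Definition right_edge (e : nat) : K :=
  if T (ht m.+3 e) then if vert m.+3 e then rho (vert m.+2 (ht m.+3 e)) else 1
  else if guarded e then wt_out (vert m.+3 e) else wt_any (vert m.+3 e).

Lemma criticalP a : a \in B -> [/\ (a < C m.+3)%N, (rise m.+2 a <= C m.+3)%N,
  (forall l, a <= l < rise m.+2 a -> T l)%N & (forall l, gap_start r m.+2 a <= l < a -> ~~ T l)%N].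
Proof.
move=> /hB; rewrite mem_filter mem_iota /= add0n => /andP[/andP[/all_rangeP h1 /has_rangeP h2] aC].
have at_ := rise_gt r m.+2 a.
split=> //.
  rewrite -(prednK (leq_ltn_trans (leq0n _) at_)); apply: hT; apply: h1.
  by rewrite -ltnS prednK ?leqnn ?andbT //; apply: leq_ltn_trans at_.
by move=> l hl; apply/negP => Tl; apply: h2; exists l.
Qed.

Lemma guard_out a e : a \in B -> (pos m.+2 a - climb m.+2 a <= e < pos m.+2 a)%N ->
  T (ht m.+3 e) = false.
Proof.
move=> /criticalP[aC _ _ h] /andP[e1 e2]; apply/negbTE/h.
by rewrite -(ltn_pos hr) ?(ltnW aC) // e2 andbT; apply: ht_homo.
Qed.

Lemma prod_block_left l : (l < C m.+3)%N -> T l ->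
  \prod_(pos m.+2 l <= e < pos m.+2 l.+1) left_edge e = chosen_rho (spanned (ht m.+2 l)) (vert m.+2 l).
Proof.
move=> lC Tl; apply: prod_block_T => // [e he|]; rewrite /left_edge.
  by have [-> ->] := vert_low hr lC he; rewrite Tl.
by have [-> ->] := vert_last hr lC; rewrite Tl.
Qed.

Lemma prod_block_right l : (l < C m.+3)%N -> T l ->
  \prod_(pos m.+2 l <= e < pos m.+2 l.+1) right_edge e = rho (vert m.+2 l).
Proof.
move=> lC Tl; apply: prod_block_T => // [e he|]; rewrite /right_edge.
  by have [-> ->] := vert_low hr lC he; rewrite Tl.
by have [-> ->] := vert_last hr lC; rewrite Tl.
Qed.

Lemma prod_region a : a \in B ->
  \prod_(pos m.+2 a - climb m.+2 a <= e < pos m.+2 (rise m.+2 a)) left_edge e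
  = \prod_(pos m.+2 a - climb m.+2 a <= e < pos m.+2 (rise m.+2 a)) right_edge e.
Proof.
move=> aB; have [aC tC aT aN] := criticalP aB; have at_ := rise_gt r m.+2 a.
rewrite !(big_cat_nat (leq_subr (climb m.+2 a) (pos m.+2 a)) (pos_homo hr m.+1 (ltnW at_))) /=.
rewrite (eq_big_nat _ _ (F2 := fun e => wt_any (vert m.+3 e))) => [|e he]; last first.
  by rewrite /left_edge (guard_out aB he).
rewrite [in RHS](eq_big_nat _ _ (F2 := fun e => wt_out (vert m.+3 e))) => [|e he]; last first.
  rewrite /right_edge (guard_out aB he).
  by have -> : guarded e by apply/hasP; exists a.
rewrite !(prod_blocks _ (p := pos m.+2)) ?(ltnW at_) //; last first.
- by move=> j; apply/ltnW/ltn_posS.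
- by move=> j; apply/ltnW/ltn_posS.
rewrite [X in _ * X = _](eq_big_nat _ _ (F2 := fun l => chosen_rho true (vert m.+2 l))) => [|l hl].
  rewrite [X in _ = _ * X](eq_big_nat _ _ (F2 := fun l => chosen_rho false (vert m.+2 l))) => [|l hl].
    exact: critical_region.
  by rewrite prod_block_right ?aT // hT ?aT.
have Tl := aT _ hl; rewrite prod_block_left ?hT //.
case hv : (vert m.+2 l); last by rewrite /chosen_rho !andbF.
congr chosen_rho; apply/hasP; exists a => //; case/andP: hl => l1 l2.
rewrite ht_homo //=; apply: leq_trans (ht_homo r m.+2 l2).
by rewrite htS // hv addn1.
Qed.

(** The regions of different critical vertices in B are disjoint by
    [critical_apart], and outside of them the factors agree. *)
Lemma prod_left_right : \prod_(0 <= e < C m.+4) left_edge e = \prod_(0 <= e < C m.+4) right_edge e.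
Proof.
(* Cuts are allowed at all positions that are not inside a region. *)
pose s a := (pos m.+2 a - climb m.+2 a)%N; pose t a := pos m.+2 (rise m.+2 a).
have st a : (s a < t a)%N.
  by apply: leq_ltn_trans (leq_subr _ _) (pos_lt hr _ (rise_gt r _ _)).
apply: (@prod_cut _ _ _ (fun z => all (fun a => (z <= s a) || (t a <= z))%N B)); last first.
  apply/allP => a /criticalP[_ tC _ _]; apply/orP; right.
  by rewrite -(pos_end hr); apply: pos_homo.
move=> z /andP[z0 zn] /allP cz.
case hh : (has (fun a => s a <= z.-1 < t a)%N B).
  have [a aB /andP[a1 a2]] := hasP hh.
  have za : z = t a.
    have := cz _ aB; rewrite -(prednK z0) ltnNge a1 /= prednK //.
    by move=> h; apply/eqP; rewrite eqn_leq h -(prednK z0) a2.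
  exists (s a); rewrite za; split=> //; last exact: prod_region.
  apply/allP => b bB; case: (ltngtP a b) => [ab|ba|->]; last by rewrite leqnn.
    have h := critical_apart hr hT (hB aB) (hB bB) ab.
    rewrite (leq_trans _ (_ : t a <= s b)%N) //; first exact: ltnW.
    rewrite /t /s pos_le //.
    by have [_] := criticalP aB.
  have h := critical_apart hr hT (hB bB) (hB aB) ba.
  apply/orP; right; rewrite /t /s pos_le //.
  by have [_] := criticalP bB.
exists z.-1; rewrite prednK //; split=> //.
  apply/allP => a aB; have := cz _ aB; have := hasPn (negbT hh) _ aB; lia.
rewrite -{2 4}(prednK z0) !big_nat1; set e := z.-1 in hh *.
have eC : (e < C m.+4)%N by rewrite /e prednK.
have [lC l1 l2] := blockP hr eC.
rewrite /left_edge /right_edge; case hTl : (T (ht m.+3 e)); last first.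
  suff -> : guarded e = false by [].
  apply/negbTE/hasPn => a aB; have := hasPn (negbT hh) _ aB; apply: contra => /andP[-> h] /=.
  exact: leq_trans h (pos_homo hr _ (ltnW (rise_gt r _ _))).
case hv : (vert m.+3 e) => //; rewrite /chosen_rho; case hv2 : (vert m.+2 (ht m.+3 e)); last by rewrite andbF.
suff -> : spanned (ht m.+2 (ht m.+3 e)) = false by [].
apply/negbTE/hasPn => a aB; have := hasPn (negbT hh) _ aB; apply: contra => /andP[h1 h2].
have [aC tC aT aN] := criticalP aB.
have e1 : (ht m.+3 e < rise m.+2 a)%N.
  by rewrite ltnNge; apply/negP => /(ht_homo r m.+2); rewrite leqNgt h2.
have e2 : (a <= ht m.+3 e)%N.
  rewrite leqNgt; apply/negP => /(ht_homo r m.+2).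
  by rewrite htS // hv2 addn1 leqNgt ltnS h1.
apply/andP; split.
  by apply: leq_trans l1; apply: leq_trans (leq_subr _ _) (pos_homo hr _ e2).
by apply: leq_trans l2 (pos_homo hr _ e1).
Qed.

End Fixed.
End CriticalRegions.

(** * The automorphism maps each sum of weights to the next one *)

Section Recursion.
Variables (r : nat) (K : unitRingType) (x y : K).
Hypothesis hr : (2 <= r)%N.
Hypotheses (ux : x \is a GRing.unit) (uy : y \is a GRing.unit).
Local Notation q := (1 + y ^+ r).
Hypothesis uq : q \is a GRing.unit.
Local Notation C := (c r).
Local Notation ht := (ht r).
Local Notation pos := (pos r).
Local Notation vert := (vert r).
Local Notation rise := (rise r).
Local Notation climb := (climb r).
Local Notation critical := (critical r).
Local Notation wt_out := (wt_out r x y).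
Local Notation wt_single := (wt_single x y).
Local Notation wt_any := (wt_any r x y).
Local Notation rho := (rho x y).
Local Notation edge_wt := (edge_wt r x y).
Local Notation up_forced := (up_forced r x y).
Local Notation chosen_rho := (chosen_rho r x y).
Local Notation good := (good r).

(** The factor of edge e when the runs are given by T, as a function of the
    choice to leave e unsupported.  A zero rules out the choice for the edges
    of runs. *)
Definition edge_term m (T : pred nat) (e : nat) (b : bool) : K :=
  if T (ht m.+2 e) then
    if b then 0 else if vert m.+2 e then rho (vert m.+1 (ht m.+2 e)) else 1
  else if b then wt_out (vert m.+2 e) else wt_single (vert m.+2 e).

Lemma prod_all_blocks m (f : nat -> K) :
  \prod_(0 <= l < C m.+3) f l
  = \prod_(0 <= j < C m.+2) \prod_(pos m.+1 j <= l < pos m.+1 j.+1) f l.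
Proof.
rewrite -prod_blocks ?pos0 ?pos_end //.
by move=> j; apply/ltnW/ltn_posS.
Qed.

Lemma forced_range n s t (S : {set 'I_n}) : (t <= n)%N ->
  forced (fun e => s <= e < t)%N S = all (nset S) (index_iota s t).
Proof.
move=> tn; apply/allP/allP => H e.
  rewrite mem_index_iota => he; have := H e; rewrite mem_iota he /=; apply.
  by case/andP: he => _ h; apply: leq_trans h tn.
by rewrite mem_iota => he; apply/implyP => h; apply: H; rewrite mem_index_iota.
Qed.

Lemma sum_next m (T : pred nat) : (forall l, T l -> (l < C m.+2)%N) ->
  \sum_(T' : {set 'I_(C m.+3)} | good m.+1 (nset T') T)
     \prod_(0 <= e < C m.+3) edge_wt m.+1 (nset T') T e
  = \sum_(S : {set 'I_(C m.+3)} |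
       all (fun a => ~~ forced (fun e => pos m.+1 a - climb m.+1 a <= e < pos m.+1 a)%N S)
           (critical m.+1 T))
     \prod_(0 <= e < C m.+3) edge_term m T e (nset S e).
Proof.
move=> hT; rewrite (reindex_inj (@setC_inj _)) /=.
pose Q (S : {set 'I_(C m.+3)}) :=
  all (fun j => T j ==> all (predC (nset S)) (block_edges r m.+1 j)) (iota 0 (C m.+2)).
have bC j e : (j < C m.+2)%N -> e \in block_edges r m.+1 j -> (e < C m.+3)%N.
  move=> jC; rewrite mem_index_iota => /andP[_ h].
  by apply: leq_trans h _; rewrite -(pos_end hr) pos_homo.
(* A set that leaves some edge of a run unsupported contributes 0. *)
rewrite [RHS](bigID Q) /= [X in _ = _ + X]big1 ?addr0; last first.
  move=> S /andP[_ /allPn[j]]; rewrite mem_iota negb_imply => /= jC /andP[Tj /allPn[e he]].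
  rewrite negbK => Se; have eC := bC _ _ jC he.
  rewrite (@prod_eq0 _ _ _ e) // /edge_term Se.
  by move: he; rewrite mem_index_iota => /(ht_block hr jC) ->; rewrite Tj.
apply: eq_big => [S|S].
  rewrite good_next // andbC; congr (_ && _).
    apply: eq_in_all => a; rewrite mem_filter mem_iota /= add0n => /andP[_ aC].
    have pC : (pos m.+1 a <= C m.+3)%N by rewrite -(pos_end hr) pos_homo // ltnW.
    rewrite forced_range // -[RHS]has_predC; apply: eq_in_has => e.
    rewrite mem_index_iota => /andP[_ h]; rewrite nsetC //.
    exact: leq_trans h pC.
  apply: eq_in_all => j; rewrite mem_iota /= => jC; congr (_ ==> _).
  by apply: eq_in_all => e /(bC _ _ jC) eC; rewrite nsetC.
rewrite good_next // => /andP[/all0P H _].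
apply: eq_big_nat => e /andP[_ eC].
have [jC j1 j2] := blockP hr eC.
rewrite /edge_wt /edge_wt /edge_term nsetC // negbK; case Se: (nset S e); last by case: (T _).
case Th: (T _) => //; have := H _ jC; rewrite Th /= => /allP /(_ e).
by rewrite mem_index_iota j1 j2 => /(_ isT); rewrite nsetC ?Se.
Qed.

Section Image.
Variable Phi : {rmorphism K -> K}.
Local Notation h := (x^-1 * q).
Hypotheses (Phix : Phi x = y) (Phiy : Phi y = y * h * y^-1).

(** The image of the weight of an unsupported edge, equal to the sum over all
    choices in the corresponding block of r - e edges (see [prod_gap_image]). *)
Definition gap_image (e : nat) : K := h ^+ (r - e) * y^-1.

Lemma unit_h : h \is a GRing.unit. Proof. by rewrite unitrMl ?unitrV. Qed.

Lemma PhiyX n : Phi (y ^+ n) = y * h ^+ n * y^-1.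
Proof.
rewrite rmorphXn Phiy; elim: n => [|n IH]; first by rewrite !expr0 mulr1 divrr.
by rewrite !exprSr IH !mulrA divrK.
Qed.

Lemma PhiyV : Phi y^-1 = y * h^-1 * y^-1.
Proof.
rewrite rmorphV // Phiy invrM ?unitrV //; last by rewrite unitrMl ?unit_h.
by rewrite invrK (invrM uy unit_h) mulrA.
Qed.

Lemma Phi_out (e : bool) : Phi (wt_out e) = gap_image e.
Proof.
rewrite /wt_out /wt_out rmorphM rmorphM rmorphV // Phix PhiyX !mulrA mulVr // mul1r /gap_image.
case: e => /=; last by rewrite subn0 expr0 rmorph1 mulr1.
rewrite expr1 PhiyV !mulrA divrK //; congr (_ * _).
have -> : h ^+ r = h ^+ (r - 1) * h by rewrite -exprSr subn1 prednK // ltnW.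
by rewrite mulrK // unit_h.
Qed.

Lemma Phi_single0 : Phi (wt_single false) = y^-1.
Proof. by rewrite /wt_single /wt_single expr0 mulr1 rmorphV // Phix. Qed.

Lemma hV : h^-1 = q^-1 * x.
Proof. by rewrite invrM ?unitrV // invrK. Qed.

Lemma Phi_single1 : Phi (wt_single true) = q^-1 * rho 1.
Proof.
rewrite /wt_single /wt_single expr1 rmorphM rmorphV // Phix PhiyV !mulrA mulVr // mul1r hV.
by rewrite /rho expr1.
Qed.

Lemma Phi_rho (v : bool) : Phi (rho v) = up_forced (r - v - 1).
Proof.
have e1 : (r - v - 1 + v.+1 = r)%N by case: v; lia.
rewrite /rho rmorphM rmorphXn Phix PhiyV hV /up_forced /up_forced /rho expr1 !mulrA; congr (_ * _ * _).
rewrite -exprSr.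
have -> : y^-1 ^+ (r - v - 1) * q^-1 = q^-1 * y^-1 ^+ (r - v - 1).
  exact: commrV (commr_sym (comm_q r y _)).
have e2 : y^-1 ^+ (r - v - 1) * y ^+ r = y ^+ v.+1.
  by rewrite -{2}e1 exprD mulrA exprVn mulVr ?unitrX // mul1r.
rewrite -[in RHS]mulrA e2.
exact: commrV (commr_sym (comm_qX r y _)).
Qed.

Definition loose (T : pred nat) (l : nat) : K := if T l then y^-1 else gap_image 0.

(** The image of the weight of block j, as a function of the choice to put its
    vertical edge in A. *)
Definition block_term m (T : pred nat) (j : nat) (b : bool) : K :=
  (\prod_(pos m.+1 j <= l < (pos m.+1 j.+1).-1) loose T l) *
  (if T (pos m.+1 j.+1).-1 then (if b then q^-1 * y ^+ r else q^-1) * rho 1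
   else if b then 0 else gap_image 1).

(** An edge of T contributes the same factor whether or not its block lies in
    a run, except for the p or 1 - p on the vertical edge; this is [Phi_rho]
    together with [Phi_single1]. *)
Lemma sum_prev m (T : pred nat) : (forall l, T l -> (l < C m.+3)%N) ->
  Phi (\sum_(A : {set 'I_(C m.+2)} | good m.+1 T (nset A))
     \prod_(0 <= l < C m.+3) edge_wt m.+1 T (nset A) l)
  = \sum_(A : {set 'I_(C m.+2)} |
       all (fun a => ~~ forced (fun j => ht m.+2 a <= j < ht m.+2 (rise m.+2 a))%N A)
           (critical m.+2 T))
     \prod_(0 <= j < C m.+2) block_term m T j (nset A j).
Proof.
move=> hT; rewrite rmorph_sum.
pose Q (A : {set 'I_(C m.+2)}) :=
  all (fun j => nset A j ==> T (pos m.+1 j.+1).-1) (iota 0 (C m.+2)).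
(* A set A with a vertical edge outside T contributes 0. *)
rewrite [RHS](bigID Q) /= [X in _ = _ + X]big1 ?addr0; last first.
  move=> A /andP[_ /allPn[j]]; rewrite mem_iota negb_imply => /= jC /andP[Aj nT].
  by rewrite (@prod_eq0 _ _ _ j) // /block_term Aj (negbTE nT) mulr0.
have goodQ A : good m.+1 T (nset A) = Q A &&
    all (fun a => ~~ forced (fun j => ht m.+2 a <= j < ht m.+2 (rise m.+2 a))%N A) (critical m.+2 T).
  rewrite (good_prev hr hT (@nset_lt _ A)); congr (_ && _); apply: eq_in_all => a aT.
  have [_ tC _ _] := criticalP hT (B := critical m.+2 T) (fun _ => id) aT.
  by rewrite forced_range // -(ht_end hr m.+1); apply: ht_homo.
apply: eq_big => [A|A gA]; first by rewrite goodQ andbC.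
have [/andP[/all0P bl _] /andP[/all0P QA _]] := (gA, etrans (esym (goodQ A)) gA).
rewrite rmorph_prod prod_all_blocks.
apply: eq_big_nat => j /andP[_ jC].
have [vl hl] := vert_last hr jC; have QAj := QA _ jC.
rewrite block_recr // /block_term; set l := (pos m.+1 j.+1).-1 in vl hl QAj *.
have wl : Phi (edge_wt m.+1 T (nset A) l) =
  if nset A j then up_forced (r - vert m.+1 j - 1) else if T l then q^-1 * rho 1 else gap_image 1.
  rewrite /edge_wt /edge_wt vl hl; case Tl: (T l) => /=; last first.
    by rewrite (Phi_out true); move: QAj; rewrite Tl implybF => /negbTE->.
  by case: (nset A j) => /=; [rewrite Phi_rho | rewrite Phi_single1].
have we e : (pos m.+1 j <= e < l)%N ->
    Phi (edge_wt m.+1 T (nset A) e) = if nset A j then 1 else loose T e.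
  move=> he; have [ve he'] := vert_low hr jC he.
  rewrite /edge_wt /edge_wt ve he' /loose; case Te : (T e) => /=.
    by case: (nset A j); rewrite /= ?rmorph1 ?Phi_single0.
  case Aj : (nset A j); last by rewrite (Phi_out false).
  have := bl _ jC; rewrite Aj /= => /allP /(_ e); rewrite mem_index_iota Te.
  case/andP: he => -> he /=; rewrite (ltn_trans he) //; first by move=> /(_ isT).
  by rewrite /l block_lastK.
rewrite wl (eq_big_nat _ _ we); case Aj : (nset A j) => //.
rewrite big1 // mul1r; move: QAj; rewrite Aj /= => ->.
rewrite (eq_big_nat _ _ (F2 := fun=> y^-1)) => [|e he].
  by rewrite prodr_const_nat /l block_last_sub // mulrA.
rewrite /loose; have := bl _ jC; rewrite Aj /= => /allP /(_ e); rewrite mem_index_iota.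
case/andP: he => -> he /=; rewrite (ltn_trans he); first by move=> /(_ isT)->.
by rewrite /l block_lastK.
Qed.

Lemma prod_gap_image m l : (l < C m.+2)%N ->
  \prod_(pos m.+1 l <= e < pos m.+1 l.+1) wt_any (vert m.+2 e) = gap_image (vert m.+1 l).
Proof.
move=> lC; rewrite block_recr // (eq_big_nat _ _ (F2 := fun=> h)) => [|e he].
  have [-> _] := vert_last hr lC.
  rewrite prodr_const_nat block_last_sub // /wt_any /wt_any expr1 mulrA -exprSr /gap_image.
  by congr (_ ^+ _ * _); case: vert; lia.
have [-> _] := vert_low hr lC he.
by rewrite /wt_any /wt_any expr0 mulr1.
Qed.

Lemma out_single_split : q^-1 * y ^+ r + q^-1 = 1.
Proof. by rewrite -{2}[q^-1]mulr1 -mulrDr [y ^+ r + 1]addrC mulVr. Qed.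

(** T is both the support of the collections on the left and the set of
    vertical edges in the runs on the right. *)
Lemma step_fixed m (T : pred nat) : (forall l, T l -> (l < C m.+3)%N) ->
  Phi (\sum_(A : {set 'I_(C m.+2)} | good m.+1 T (nset A))
     \prod_(0 <= l < C m.+3) edge_wt m.+1 T (nset A) l)
  = \sum_(T' : {set 'I_(C m.+4)} | good m.+2 (nset T') T)
     \prod_(0 <= e < C m.+4) edge_wt m.+2 (nset T') T e.
Proof.
move=> hT; rewrite sum_prev // sum_next //; apply: incl_excl => B hB.
apply: etrans (etrans (prod_left_right hr ux uy uq hT hB) _).
  rewrite [RHS]prod_all_blocks [RHS]prod_all_blocks.
  apply: eq_big_nat => j /andP[_ jC]; rewrite [in RHS]block_recr //.
  have eC e : (pos m.+1 j <= e < pos m.+1 j.+1)%N -> (e < C m.+3)%N.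
    by case/andP => _ he; apply: leq_trans he _; rewrite -(pos_end hr) pos_homo.
  have blk l : (l < C m.+3)%N -> ~~ T l ->
      \prod_(pos m.+2 l <= e < pos m.+2 l.+1) left_edge r x y m T B e = gap_image (vert m.+2 l).
    move=> lC nT; rewrite -prod_gap_image //; apply: eq_big_nat => e he.
    by rewrite /left_edge (ht_block hr lC he) (negbTE nT).
  have E1 : \prod_(pos m.+1 j <= i < (pos m.+1 j.+1).-1)
      \prod_(pos m.+2 i <= l < pos m.+2 i.+1) left_edge r x y m T B l
      = \prod_(pos m.+1 j <= l < (pos m.+1 j.+1).-1) loose T l.
    apply: eq_big_nat => l hl; have [vl hl'] := vert_low hr jC hl.
    have lC : (l < C m.+3)%N.
      by apply: eC; case/andP: hl => -> /= h; apply: ltn_trans h _; rewrite block_lastK.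
    rewrite /loose; case Tl : (T l); last by rewrite blk ?Tl // vl.
    by rewrite prod_block_left // vl /chosen_rho /chosen_rho andbF /rho expr0 mul1r.
  have [vl hl'] := vert_last hr jC; have lC : ((pos m.+1 j.+1).-1 < C m.+3)%N.
    by apply: eC; rewrite block_lastK // leqnn block_last_ge.
  rewrite E1 /block_term -mulrDr; set P := \prod_(_ <= _ < _) loose T _.
  rewrite -(fun_if (fun z => P * z)); congr (_ * _).
  case Tl : (T (pos m.+1 j.+1).-1); last first.
    rewrite blk ?Tl // vl add0r; case: ifP => // /hasP[a aB /andP[j1 j2]]; exfalso.
    have [aC tC aT aN] := criticalP hT hB aB.
    suff : T (pos m.+1 j.+1).-1 by rewrite Tl.
    apply: aT; apply/andP; split.
      rewrite leqNgt; apply/negP => ha.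
      have := ht_homo r m.+2 ha; rewrite htS // hl' vl addn1.
      by rewrite leqNgt ltnS j1.
    rewrite ltnNge; apply/negP => /(ht_homo r m.+2); rewrite hl'.
    by rewrite leqNgt j2.
  rewrite prod_block_left // hl' vl /chosen_rho /chosen_rho andbT -mulrDl out_single_split mul1r.
  by [].
apply: eq_big_nat => e /andP[_ eC]; rewrite /right_edge /edge_term.
case: ifP => hTe; last by rewrite out_single.
rewrite add0r; case hb: (has _ _) => //; have /hasP[a aB ha] := hb.
by rewrite (guard_out hr hT hB aB ha) in hTe.
Qed.

(** The sum for D_(m+4), which has level m + 2. *)
Definition path_sum m : K :=
  \sum_(T : {set 'I_(C m.+3)}) \sum_(A : {set 'I_(C m.+2)} | good m.+1 (nset T) (nset A))
    \prod_(0 <= l < C m.+3) edge_wt m.+1 (nset T) (nset A) l.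

Lemma path_sum_step m : Phi (path_sum m) = path_sum m.+1.
Proof.
rewrite /path_sum rmorph_sum (exchange_big_dep predT) //=; apply: eq_bigr => T _.
by apply: step_fixed; apply: nset_lt.
Qed.

(** D_3 is a single horizontal edge with sum h, and D_4 is a single block. *)
Lemma path_sum_base : path_sum 0 = Phi h.
Proof.
have C2 : C 2 = 1%N by [].
rewrite /path_sum (exchange_big_dep predT) //=.
transitivity (\sum_(T : {set 'I_(C 2)}) \prod_(0 <= l < C 2)
    (if nset T l then y^-1 else gap_image 0)).
  apply: eq_bigr => T _; apply: etrans (@sum_next 0 (nset T) (@nset_lt _ T)) _.
  (* D_3 has no vertical edge, so nothing rises. *)
  have -> : critical 1 (nset T) = [::].
    apply/eqP; rewrite -[_ == _]negbK -has_filter; apply/hasPn => a _.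
    rewrite negb_and; apply/orP; left; apply/negP => /all_rangeP h1.
    have at_ := rise_gt r 1 a.
    have tC : (rise 1 a <= C 2)%N.
      rewrite -(prednK (leq_ltn_trans (leq0n _) at_)); apply: (nset_lt (S := T)); apply: h1.
      by rewrite -ltnS prednK ?leqnn ?andbT //; apply: leq_ltn_trans at_.
    have := rise_spec hr tC; rewrite /depth (_ : C 1 = 0%N) // !muln0 !mod0n //.
  rewrite (eq_bigl predT) // sum_sets prod_all_blocks.
  apply: eq_big_nat => l /andP[_ lC].
  have v0 : vert 1 l = false by rewrite /vert /ht (_ : C 1 = 0%N) // !muln0 !div0n.
  case: ifP => Tl.
    apply: prod_block_T => // [e he|]; rewrite /edge_term.
      by have [-> ->] := vert_low hr lC he; rewrite Tl add0r.
    by have [-> ->] := vert_last hr lC; rewrite Tl add0r v0 /rho expr0 mul1r.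
  rewrite -[gap_image 0]/(gap_image false) -v0 -prod_gap_image //; apply: eq_big_nat => e he.
  by rewrite /edge_term (ht_block hr lC he) Tl v0 out_single.
rewrite (sum_sets _ (fun _ b => if b then y^-1 else gap_image 0)) C2 big_nat1.
rewrite rmorphM rmorphV // Phix rmorphD rmorph1 PhiyX mulrDr mulr1; congr (_ + _).
by rewrite !mulrA mulVr // mul1r /gap_image subn0.
Qed.

End Image.
End Recursion.

(** * The maximal Dyck path and the colors of its subpaths *)

Local Close Scope ring_scope.

Section Path.
Variable r : nat.
Hypothesis hr : 2 <= r.
Variable m : nat.
Local Notation C := (c r).
Local Notation ht := (ht r).
Local Notation depth := (depth r).
Local Notation pos := (pos r).
Local Notation vert := (vert r).
Local Notation rise := (rise r).
Local Notation climb := (climb r).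

(** D_(m+4) as the sequence of steps read off from the heights. *)
Definition Dmax : seq bool := mkseq (vert m.+2) (C m.+3).

Lemma count_take_nth (s : seq bool) l : l < size s ->
  count id (take l.+1 s) = count id (take l s) + nth false s l.
Proof. by move=> h; rewrite (take_nth false) // -cats1 count_cat /= addn0. Qed.

Lemma count_negb (s : seq bool) : count negb s = size s - count id s.
Proof. by rewrite -(count_predC id s) addKn. Qed.

Lemma vertexE (s : seq bool) p : p <= size s ->
  vertex s p = (p - count id (take p s), count id (take p s)).
Proof. by move=> h; rewrite /vertex count_negb size_takel. Qed.

Lemma count_Dmax p : p <= C m.+3 -> count id (take p Dmax) = ht m.+2 p.
Proof.
elim: p => [|p IH] h; first by rewrite take0 ht0.
by rewrite count_take_nth ?size_mkseq // nth_mkseq // IH ?(ltnW h) // htS.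
Qed.

Lemma vertex_Dmax p : p <= C m.+3 -> vertex Dmax p = (p - ht m.+2 p, ht m.+2 p).
Proof. by move=> h; rewrite vertexE ?size_mkseq // count_Dmax. Qed.

Lemma ht_dyck p : ht m.+2 p * (C m.+3 - C m.+2) <= C m.+2 * (p - ht m.+2 p).
Proof.
have := ht_depth r m.+2 p; have := ht_le hr m.+1 p; have := ltnW (c_mono hr m.+1).
move=> h1 h2 h3; move: h1 h2 h3; set k := ht m.+2 p => h1 h2 h3.
rewrite (mulnBr k (C m.+3)) (mulnBr (C m.+2) p) (mulnC (C m.+2) p) h3 (mulnC (C m.+2)).
by lia.
Qed.

Lemma dyck_Dmax : dyck_path (C m.+3 - C m.+2) (C m.+2) Dmax.
Proof.
rewrite /dyck_path size_mkseq vertex_Dmax // ht_end // eqxx andTb.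
apply/allP => z /mapP[p]; rewrite mem_iota size_mkseq add0n => /andP[_ hp] ->.
by rewrite vertex_Dmax //= ht_dyck.
Qed.

(** The heights of any Dyck path are bounded by the integral parts that define
    [ht], and [Dmax] attains these bounds. *)
Lemma maximal_Dmax D :
  maximal_dyck_path (C m.+3 - C m.+2) (C m.+2) D -> D = Dmax.
Proof.
move=> [/andP[/eqP eD /allP hD] hmax].
have sD : size D = C m.+3.
  move: eD; rewrite vertexE // take_size => -[e1 e2].
  have := count_size id D; have := ltnW (c_mono hr m.+1); lia.
have up p : p <= C m.+3 -> count id (take p D) <= ht m.+2 p.
  move=> hp; have := hD (vertex D p); rewrite map_f; last by rewrite mem_iota sD.
  rewrite vertexE ?sD //= => /(_ isT) h.
  rewrite /ht leq_divRL ?c_gt0 //; have := ltnW (c_mono hr m.+1).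
  have : count id (take p D) <= p.
    by apply: leq_trans (count_size _ _) _; rewrite size_take; case: ltnP; rewrite ?sD.
  move: h; set k := count _ _ => h1 h2 h3; move: h1.
  rewrite (mulnBr k (C m.+3)) (mulnBr (C m.+2) p) (mulnC (C m.+2) p) (mulnC (C m.+2)).
  have : k * C m.+2 <= k * C m.+3 by rewrite leq_mul2l h3 orbT.
  have : k * C m.+2 <= p * C m.+2 by rewrite leq_mul2r h2 orbT.
  lia.
have low p : p <= C m.+3 -> ht m.+2 p <= count id (take p D).
  move=> hp; have := allP (hmax _ dyck_Dmax) (vertex Dmax p).
  rewrite map_f ?mem_iota ?size_mkseq // => /(_ isT) /hasP[z /mapP[p2]].
  rewrite mem_iota sD add0n => /andP[_ hp2] ->.
  rewrite vertexE ?sD // vertex_Dmax //= => /andP[/eqP e1 h1].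
  have hle := ht_le hr m.+1 p.
  have k2 : count id (take p2 D) <= p2.
    by apply: leq_trans (count_size _ _) _; rewrite size_take; case: ltnP; rewrite ?sD.
  have pp : p <= p2 by lia.
  have : count id (take p2 D) <= count id (take p D) + (p2 - p).
    rewrite -{1}(subnKC pp) takeD count_cat leq_add2l.
    by apply: leq_trans (count_size _ _) _; rewrite size_take; case: ltnP => // /ltnW.
  lia.
apply: (@eq_from_nth _ false) => [|l]; first by rewrite size_mkseq.
rewrite sD => hl.
have e p : p <= C m.+3 -> count id (take p D) = ht m.+2 p.
  by move=> hp; apply/eqP; rewrite eqn_leq up ?low.
have := count_take_nth (s := D) (l := l); rewrite sD => /(_ hl).
rewrite nth_mkseq // !e ?(ltnW hl) // htS //.
by move/addnI; case: nth; case: (vert _ _).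
Qed.

Lemma find_iota0 (P : pred nat) N k : k < N -> P k -> (forall p, p < k -> ~~ P p) ->
  find P (iota 0 N) = k.
Proof.
move=> kN Pk H; apply/eqP; rewrite eqn_leq; apply/andP; split.
  rewrite leqNgt; apply/negP => /(before_find 0).
  by rewrite nth_iota // add0n Pk.
rewrite leqNgt; apply/negP => lt.
have hh : has P (iota 0 N) by apply/hasP; exists k; rewrite // mem_iota.
have := nth_find 0 hh; rewrite nth_iota ?add0n; last exact: ltn_trans lt kN.
exact/negP/H.
Qed.

Lemma vpos_Dmax j : j <= C m.+2 -> vpos Dmax j = pos m.+1 j.
Proof.
move=> hj; have pC : pos m.+1 j <= C m.+3 by rewrite -(pos_end hr) pos_homo.
rewrite /vpos size_mkseq; apply: find_iota0 => // [|p hp].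
  by rewrite vertex_Dmax //= ht_pos.
rewrite vertex_Dmax /=; last by apply: leq_trans (ltnW hp) pC.
by rewrite neq_ltn -ltn_pos // hp.
Qed.

Lemma v_Dmax j : j <= C m.+2 -> v Dmax j = (pos m.+1 j - j, j).
Proof.
move=> hj; rewrite /v vpos_Dmax // vertex_Dmax ?ht_pos //.
by rewrite -(pos_end hr) pos_homo.
Qed.

(** Clearing denominators in the comparison of slopes leaves a comparison of
    depths on the previous level, since the substitution has determinant 1. *)
Lemma steep_nat i t : i < t -> t <= C m.+2 ->
  (C m.+2 * ((pos m.+1 t - t) - (pos m.+1 i - i)) < (t - i) * (C m.+3 - C m.+2))
  = (depth m.+1 t < depth m.+1 i).
Proof.
move=> it tC; have := pos_sub hr m (ltnW it).
have := leq_idpos hr m t; have := leq_idpos hr m i; have := pos_homo hr m (ltnW it).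
have := ht_depth r m.+1 i; have := ht_depth r m.+1 t; have := c_rec hr m.
have hh := ht_homo r m.+1 (ltnW it); have := c_mono hr m.+1.
set B := C m.+2; set N := C m.+3; set C1 := C m.+1.
move=> BN eN et ei ppit ii tt ps.
have -> : (pos m.+1 t - t) - (pos m.+1 i - i) = pos m.+1 t - pos m.+1 i - (t - i) by lia.
set X := pos m.+1 t - pos m.+1 i in ps *; set dh := ht m.+1 t - ht m.+1 i in ps.
have e1 : X * B + dh * B = (t - i) * N + (t - i) * C1.
  by rewrite -mulnDl ps -mulnDr eN mulnAC mulnA [(t - i) * r]mulnC mulnAC.
have e2 : (t - i) * C1 + depth m.+1 i = dh * B + depth m.+1 t.
  have : ht m.+1 i * B <= ht m.+1 t * B by rewrite leq_mul2r hh orbT.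
  have : i * C1 <= t * C1 by rewrite leq_mul2r ltnW ?orbT.
  by rewrite /dh !mulnBl; lia.
have : (t - i) * B < (t - i) * N by rewrite ltn_pmul2l ?subn_gt0.
rewrite (mulnBr (t - i) N) (mulnBr B X) [B * X]mulnC [B * (t - i)]mulnC.
case: (leqP (t - i) X) => hX.
  have : (t - i) * B <= X * B by rewrite leq_mul2r hX orbT.
  by lia.
have : X * B < (t - i) * B by rewrite ltn_pmul2r ?c_gt0.
lia.
Qed.

Lemma steep_Dmax i t : i < t -> t <= C m.+2 ->
  steep r m.+4 Dmax i t = (depth m.+1 t < depth m.+1 i).
Proof.
move=> it tC; have iC := ltnW (leq_trans it tC).
rewrite /steep -steep_nat // !v_Dmax // pos0 pos_end // /slope /= subnn.
have NB : 0 < C m.+3 - C m.+2 by rewrite subn_gt0 c_mono.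
rewrite (ltn_eqF NB) !subr0.
have pi : i <= pos m.+1 i := leq_idpos hr m i.
have pt : t <= pos m.+1 t := leq_idpos hr m t.
have ppit : pos m.+1 i - i <= pos m.+1 t - t.
  have := pos_sub hr m (ltnW it).
  have : ht m.+1 t - ht m.+1 i <= t - i.
    rewrite -{1}(subnKC (ltnW it)); elim: (t - i) => [|k IH]; first by rewrite addn0 subnn.
    by rewrite addnS htS //; case: (vert _ _); lia.
  have : 2 * (t - i) <= r * (t - i) by rewrite leq_mul2r hr orbT.
  lia.
case: ifP => [/eqP e|/eqP ne].
  by rewrite e subnn muln0 /= muln_gt0 subn_gt0 it NB.
have lt : pos m.+1 i - i < pos m.+1 t - t by rewrite ltn_neqAle ppit andbT; apply/eqP.
rewrite -!natrB ?(ltnW it) //=.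
rewrite ltr_pdivrMr ?ltr0n // mulrAC ltr_pdivlMr ?ltr0n ?subn_gt0 //.
by rewrite -!natrM ltr_nat.
Qed.

Lemma filter_none (P : pred nat) s : {in s, forall t, ~~ P t} -> filter P s = [::].
Proof. by move=> H; apply/eqP; rewrite -[_ == _]negbK -has_filter; apply/hasPn. Qed.

Lemma first_steep_Dmax i k : i < k -> k <= C m.+2 ->
  first_steep r m.+4 Dmax i k = if rise m.+1 i <= k then Some (rise m.+1 i) else None.
Proof.
move=> ik kC; rewrite /first_steep.
have -> : [seq t <- iota i.+1 (k - i) | steep r m.+4 Dmax i t]
        = [seq t <- iota i.+1 (k - i) | depth m.+1 t < depth m.+1 i].
  apply: eq_in_filter => t; rewrite mem_iota => ht'; rewrite steep_Dmax //; lia.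
have it := rise_gt r m.+1 i; case: (leqP (rise m.+1 i) k) => tk; last first.
  rewrite filter_none // => t; rewrite mem_iota -leqNgt => ht'.
  apply: rise_before; lia.
have -> : k - i = (rise m.+1 i - i.+1) + (k - rise m.+1 i).+1 by lia.
rewrite iotaD filter_cat (@filter_none _ (iota i.+1 _)); last first.
  by move=> t; rewrite mem_iota -leqNgt => ht'; apply: rise_before; lia.
rewrite /= subnKC //; rewrite (rise_spec hr) //; exact: leq_trans tk kC.
Qed.

(** The pair (mu, w) is determined by the length of the rise ([form_uniq]), so
    the number of edges in the green condition is always [climb]. *)
Lemma mw_green_rise mu w i k : i < k -> k <= C m.+2 -> mw_green r m.+4 Dmax mu w i k ->
  [/\ rise m.+1 i <= k, climb m.+1 i = C mu.-1 - w * C mu.-2 & rise m.+1 i != i.+1].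
Proof.
move=> ik kC; rewrite /mw_green first_steep_Dmax //; case: ifP => // tk.
move=> /and3P[/andP[m3 mn] hw /eqP e]; have tC := leq_trans tk kC.
have it := rise_gt r m.+1 i.
case: mu m3 mn e => [|[|[|nu]]] //= _ mn e.
have e' : rise m.+1 i - i + w * C nu.+2 = C nu.+3.
  by move: e; lia.
have /andP[b1 b2] := form_bounds hr hw e'; have c0 := c_gt0 hr nu.
split=> //; last by apply/eqP; lia.
case: (rise_form hr tC) => [[h1 h2]|[nu2 [w2 [h1 hw2 h3 h4]]]]; first by lia.
have [en ew] := form_uniq hr hw hw2 e' h3.
by move: h4; rewrite -en -ew; lia.
Qed.

Lemma rise_mw_green i k : i < k -> k <= C m.+2 -> rise m.+1 i <= k -> rise m.+1 i != i.+1 ->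
  exists (mu : 'I_m.+4) (w : 'I_r), mw_green r m.+4 Dmax mu w i k.
Proof.
move=> ik kC tk tn; have tC := leq_trans tk kC; have it := rise_gt r m.+1 i.
case: (rise_form hr tC) => [[h1 h2]|[nu [w [h1 hw h3 h4]]]].
  by case/eqP: tn; lia.
have hmu : nu.+3 < m.+4 by lia.
have hwr : w < r by lia.
exists (Ordinal hmu), (Ordinal hwr); rewrite /mw_green first_steep_Dmax // tk.
by apply/and3P; split=> //=; lia.
Qed.

(** By [rise_form] a rise of length greater than one has the form required of
    green subpaths. *)
Lemma red_Dmax i k : i < k -> k <= C m.+2 -> red r m.+4 Dmax i k = (rise m.+1 i == i.+1).
Proof.
move=> ik kC; rewrite /red /blue first_steep_Dmax //.
case: (boolP (rise m.+1 i <= k)) => tk /=; last first.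
  by apply/esym/eqP => e; move: tk; rewrite e ik.
apply/idP/idP.
  apply: contraR => tn; apply/existsP.
  have [mu [w h]] := rise_mw_green ik kC tk tn.
  by exists mu; apply/existsP; exists w.
move=> /eqP e; apply/negP => /existsP[mu /existsP[w h]].
by have [_ _] := mw_green_rise ik kC h; rewrite e eqxx.
Qed.

End Path.

(** * Collections of subpaths as pairs of edge sets *)

Section Bijection.
Variable r : nat.
Hypothesis hr : 2 <= r.
Variable m : nat.
Local Notation C := (c r).
Local Notation ht := (ht r).
Local Notation pos := (pos r).
Local Notation rise := (rise r).
Local Notation climb := (climb r).
Local Notation good := (good r).
Local Notation D := (Dmax r m).
Local Notation lab := (label r m.+4).
Local Notation ends := ('I_(C m.+4.-2).+1 * 'I_(C m.+4.-2).+1)%type.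

(** Whether alpha(i,k) is red depends only on i, so its first vertex does not
    depend on k. *)
Definition start i := pos m.+1 i - (rise m.+1 i == i.+1).

Lemma ends_le (ik : ends) : (ik.1 <= C m.+2) * (ik.2 <= C m.+2).
Proof. by split; rewrite -ltnS. Qed.

Lemma in_alphaE i k l : i < k -> k <= C m.+2 ->
  in_alpha r m.+4 D i k l = (start i <= l < pos m.+1 k).
Proof.
move=> ik kC; have iC : i <= C m.+2 by apply: leq_trans (ltnW ik) kC.
rewrite /in_alpha /alpha_start red_Dmax // !vpos_Dmax // /start.
by case: eqP => _; rewrite ?subn1 ?subn0.
Qed.

Lemma start_le i : start i <= pos m.+1 i.
Proof. exact: leq_subr. Qed.

Lemma start_before i l : start i <= l -> l < pos m.+1 i -> l.+1 = pos m.+1 i /\ start i = l.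
Proof. by rewrite /start; case: eqP => _; lia. Qed.

Lemma start_ge i k : k < i -> pos m.+1 k <= start i.
Proof.
move=> ki; rewrite /start; have := leq_trans (ltn_posS hr m k) (pos_homo hr m ki).
by case: eqP => _; lia.
Qed.

Section FromBeta.
Variable beta : {set lab}.
Hypothesis hb : beta \in FD r m.+4 D.

Definition supp : pred nat := supported D beta.
Definition in_runs : pred nat := fun j =>
  [exists ik : ends, has_alpha beta ik && (ik.1 <= j < ik.2)].

Lemma in_runsP j : in_runs j -> exists2 ik, has_alpha beta ik & ik.1 <= j < ik.2.
Proof. by case/existsP => ik /andP[h hj]; exists ik. Qed.

Lemma beta_lt ik : has_alpha beta ik -> ik.1 < ik.2.
Proof.
move: hb; rewrite inE => /and4P[/subsetP h _ _ _] /h.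
by rewrite inE.
Qed.

Lemma beta_disj p q l : p \in beta -> q \in beta -> l < C m.+3 ->
  in_label D p l -> in_label D q l -> p = q.
Proof.
move: hb; rewrite inE => /and4P[_ /forall_inP h _ _] pb qb lN pl ql.
apply/eqP; apply: contraT => ne; have /forall_inP/(_ _ qb) := h _ pb.
by rewrite ne => /forallP/(_ (Ordinal lN)) /=; rewrite pl ql.
Qed.

(** Two subpaths without common edge meet at most at an end point v_i, which
    the definition of F(D_n) excludes. *)
Lemma beta_sep ik jl : has_alpha beta ik -> has_alpha beta jl -> ik != jl ->
  ik.2 < jl.1 \/ jl.2 < ik.1.
Proof.
move=> h1 h2 ne; have [l1 l2] := (beta_lt h1, beta_lt h2).
have [[a1 a2] [b1 b2]] := (ends_le ik, ends_le jl).
have [n1 n2] : ik.1 != jl.2 :> nat /\ jl.1 != ik.2 :> nat.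
  move: hb; rewrite inE => /and4P[_ _ /forallP h _].
  by have /forallP/(_ jl) := h ik; rewrite h1 h2 => /andP[].
have disj l : l < C m.+3 -> start ik.1 <= l < pos m.+1 ik.2 -> start jl.1 <= l < pos m.+1 jl.2 -> False.
  move=> lN i1 i2; move/eqP: ne; apply.
  have [//] : inl ik = inl jl :> lab.
  by apply: (@beta_disj _ _ l) => //=; rewrite in_alphaE.
have pN k : k <= C m.+2 -> pos m.+1 k <= C m.+3 by rewrite -(pos_end hr); apply: pos_homo.
case: (ltngtP ik.2 jl.1) => [|lt|e]; [by left| |by rewrite e eqxx in n2].
case: (ltngtP jl.2 ik.1) => [|lt2|e]; [by right| |by rewrite e eqxx in n1].
exfalso; pose j := maxn ik.1 jl.1.
have [j1 j2] : j < ik.2 /\ j < jl.2 by rewrite !gtn_max l1 l2 lt lt2.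
apply: (disj (pos m.+1 j)).
- by apply: leq_trans (pN _ a2); apply: pos_lt.
- by rewrite pos_lt // andbT; apply: leq_trans (start_le _) (pos_homo hr m _); apply: leq_maxl.
- by rewrite pos_lt // andbT; apply: leq_trans (start_le _) (pos_homo hr m _); apply: leq_maxr.
Qed.

Lemma supp_lt l : supp l -> l < C m.+3.
Proof.
move=> /exists_inP[[ik|e] pb] /=; last by move/eqP->; apply: ltn_ord.
have [a1 a2] := ends_le ik; rewrite in_alphaE ?(beta_lt pb) // => /andP[_ h].
by apply: leq_trans h _; rewrite -(pos_end hr) pos_homo.
Qed.

Lemma in_runs_lt j : in_runs j -> j < C m.+2.
Proof. by case/existsP => ik /and3P[_ _ h]; apply: leq_trans h (ends_le ik).2. Qed.

Lemma supp_alpha ik l : has_alpha beta ik -> start ik.1 <= l < pos m.+1 ik.2 -> supp l.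
Proof.
move=> h hl; apply/exists_inP; exists (inl ik) => //=.
by rewrite in_alphaE ?(beta_lt h) // ends_le.
Qed.

Lemma in_runs_alpha ik j : has_alpha beta ik -> ik.1 <= j < ik.2 -> in_runs j.
Proof. by move=> h hj; apply/existsP; exists ik; rewrite h. Qed.

Lemma in_runs_before ik : has_alpha beta ik -> 0 < ik.1 -> ~~ in_runs ik.1.-1.
Proof.
move=> h i0; apply/negP => /existsP[jl /and3P[h2 j1 j2]].
have [e|ne] := eqVneq ik jl; first by move: j1; rewrite -e; lia.
by have := beta_lt h; case: (beta_sep h h2 ne); lia.
Qed.

Lemma in_runs_after ik : has_alpha beta ik -> ~~ in_runs ik.2.
Proof.
move=> h; apply/negP => /existsP[jl /and3P[h2 j1 j2]].
have [e|ne] := eqVneq ik jl; first by move: j2; rewrite -e; lia.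
by have := beta_lt h; case: (beta_sep h h2 ne); lia.
Qed.

Lemma good_beta : good m.+1 supp in_runs.
Proof.
apply/andP; split.
  apply/all0P => j jC; apply/implyP => /existsP[ik /and3P[h j1 j2]].
  apply/all_rangeP => l /andP[l1 l2]; apply: (supp_alpha h); apply/andP; split.
    by apply: leq_trans l1; apply: leq_trans (start_le _) (pos_homo hr m j1).
  by apply: leq_trans l2 (pos_homo hr m j2).
apply/all0P => a aC; apply/implyP => /all_rangeP hA.
have at_ := rise_gt r m.+1 a.
have /existsP[ik /and3P[h i1 i2]] : in_runs a by apply: hA; rewrite leqnn.
have [k1 k2] := ends_le ik.
have tk : rise m.+1 a <= ik.2.
  rewrite leqNgt; apply/negP => lt.
  by have /negP := in_runs_after h; apply; apply: hA; rewrite ltnW.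
have tC := leq_trans tk k2.
have c0 : 0 < climb m.+1 a by rewrite climbE.
have a0 : 0 < a.
  by have := rise_spec (r := r) hr tC; case: (posnP a) => // ->; rewrite depth0.
have p0 : 0 < pos m.+1 a by apply: leq_trans (leq_idpos hr m a).
have last_ok : start ik.1 <= (pos m.+1 a).-1 -> has supp (guard_edges r m.+1 a).
  move=> h1; apply/has_rangeP; exists (pos m.+1 a).-1; first by lia.
  apply: (supp_alpha h); rewrite h1 /= prednK //.
  by apply: pos_homo => //; apply: ltnW.
move: i1; rewrite leq_eqVlt => /orP[/eqP e|lt].
  have [et|nt] := eqVneq (rise m.+1 a) a.+1.
    by apply: last_ok; rewrite e /start et eqxx subn1.
  have [mu [w hg]] := rise_mw_green hr i2 k2 tk nt.
  have [_ ec _] := mw_green_rise hr i2 k2 hg.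
  move: hb; rewrite inE => /and4P[_ _ _ /forallP hG].
  have /forallP/(_ mu)/forallP/(_ w) := hG ik; rewrite e h hg /= => /existsP[l /andP[hl sl]].
  apply/has_rangeP; exists l => //; rewrite ec.
  by move: hl; rewrite vpos_Dmax // ltnW.
apply: last_ok; apply: leq_trans (start_le _) _.
by rewrite -ltnS prednK // pos_lt.
Qed.

End FromBeta.

(** Maximal runs: no larger interval is contained in A.  They are the subpaths
    in the collection because touching subpaths are excluded. *)
Definition is_run (A : pred nat) i k : bool :=
  [&& i < k, all A (index_iota i k), (i == 0) || ~~ A i.-1 & ~~ A k].

Section Runs.
Variables (A : pred nat).
Hypothesis hA : forall j, A j -> j < C m.+2.

Lemma is_run_in i k j : is_run A i k -> i <= j < k -> A j.
Proof. by case/and4P => _ /all_rangeP h _ _; apply: h. Qed.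

Lemma is_run_le i k : is_run A i k -> k <= C m.+2.
Proof.
move=> hR; have /and4P[ik _ _ _] := hR.
by rewrite -(prednK (leq_ltn_trans (leq0n i) ik)) hA // (is_run_in hR) //; lia.
Qed.

Lemma is_run_uniq i k i' k' j : is_run A i k -> is_run A i' k' ->
  i <= j < k -> i' <= j < k' -> i = i' /\ k = k'.
Proof.
move=> h h' /andP[j1 j2] /andP[j1' j2'].
have aux1 a b a' b' : is_run A a b -> is_run A a' b' -> a <= j < b -> a' <= j < b' -> ~ a < a'.
  move=> H H' H1 H2 lt; case/and4P: (H') => _ _ /orP[/eqP e|/negP nn] _; first by lia.
  by apply: nn; apply: (is_run_in H); lia.
have aux2 a b a' b' : is_run A a b -> is_run A a' b' -> a <= j < b -> a' <= j < b' -> ~ b < b'.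
  move=> H H' H1 H2 lt; case/and4P: (H) => _ _ _ /negP; apply.
  by apply: (is_run_in H'); lia.
have := aux1 _ _ _ _ h h'; have := aux1 _ _ _ _ h' h; have := aux2 _ _ _ _ h h'; have := aux2 _ _ _ _ h' h.
rewrite j1 j2 j1' j2' => /(_ isT isT) a1 /(_ isT isT) a2 /(_ isT isT) a3 /(_ isT isT) a4.
by split; lia.
Qed.

Lemma is_run_exists j : A j -> exists i k, is_run A i k /\ i <= j < k.
Proof.
move=> Aj; pose P i := (i <= j) && all A (index_iota i j.+1).
have exP : exists i, P i.
  by exists j; rewrite /P leqnn; apply/all_rangeP => l; rewrite ltnS -eqn_leq => /eqP<-.
have [i /andP[i1 /all_rangeP i2] imin] := ex_minnP exP.
pose Q k := (j < k) && ~~ A k.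
have exQ : exists k, Q k.
  exists (C m.+2); rewrite /Q hA //=; apply/negP => /hA; lia.
have [k /andP[k1 k2] kmin] := ex_minnP exQ.
exists i, k; split; last by rewrite i1.
apply/and4P; split=> //; first by lia.
  apply/all_rangeP => l /andP[l1 l2]; case: (leqP l j) => lj; first by apply: i2; rewrite l1.
  apply: contraT => nA; have := kmin l; rewrite /Q lj nA => /(_ isT); lia.
case: (posnP i) => //= i0; apply/negP => Ai.
have := imin i.-1; rewrite /P => H; suff : i <= i.-1 by lia.
apply: H; apply/andP; split; first by lia.
apply/all_rangeP => l /andP[l1 l2]; have [->//|lt] : l = i.-1 \/ i <= l by lia.
by apply: i2; rewrite lt.
Qed.

Lemma is_run_sep i k i' k' : is_run A i k -> is_run A i' k' -> (i, k) <> (i', k') ->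
  k < i' \/ k' < i.
Proof.
move=> h h' ne; have /and4P[l1 _ _ nk] := h; have /and4P[l2 _ _ nk'] := h'.
have n1 : k <> i' by move=> e; move/negP: nk; apply; rewrite e; apply: (is_run_in h'); lia.
have n2 : k' <> i by move=> e; move/negP: nk'; apply; rewrite e; apply: (is_run_in h); lia.
have [?|?] : (k < i' \/ k' < i) \/ (i' < k /\ i < k') by lia.
  by [].
exfalso; apply: ne; have [] := @is_run_uniq i k i' k' (maxn i i') h h'; try lia.
by move=> -> ->.
Qed.

End Runs.

Definition covered A e : bool :=
  [exists ik : ends, is_run A ik.1 ik.2 && (start ik.1 <= e < pos m.+1 ik.2)].

(** The edges of T not covered by the colored subpaths become single edges. *)
Definition beta_of (T A : pred nat) : {set lab} :=
  [set p : lab | match p with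
                 | inl ik => is_run A ik.1 ik.2
                 | inr e => T e && ~~ covered A e
                 end].

Section ToBeta.
Variables T A : pred nat.
Hypothesis hT : forall l, T l -> l < C m.+3.
Hypothesis hA : forall j, A j -> j < C m.+2.
Hypothesis hg : good m.+1 T A.

Lemma has_alpha_of ik : has_alpha (beta_of T A) ik = is_run A ik.1 ik.2.
Proof. by rewrite /has_alpha inE. Qed.

Lemma run_ends i k : is_run A i k -> exists ik : ends, ik.1 = i :> nat /\ ik.2 = k :> nat.
Proof.
move=> h; have kC := is_run_le hA h; have /and4P[ik _ _ _] := h.
have i1 : i < (C m.+2).+1 by lia.
have k1 : k < (C m.+2).+1 by lia.
by exists (Ordinal i1, Ordinal k1).
Qed.

Lemma rise_run i k : is_run A i k -> k < rise m.+1 i \/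
  rise m.+1 i <= k /\ has T (guard_edges r m.+1 i).
Proof.
move=> h; case: (ltnP k (rise m.+1 i)) => tk; [by left|right; split=> //].
have kC := is_run_le hA h; have it := rise_gt r m.+1 i.
case/andP: hg => _ /all0P/(_ i); rewrite (leq_trans it (leq_trans tk kC)) => /(_ isT)/implyP; apply.
by apply/all_rangeP => l /andP[l1 l2]; apply: (is_run_in h); lia.
Qed.

(** The first edge of a red subpath lies in T as it is its only guard edge. *)
Lemma run_T i k l : is_run A i k -> start i <= l < pos m.+1 k -> T l.
Proof.
move=> h /andP[l1 l2]; have kC := is_run_le hA h; have /and4P[ik _ _ _] := h.
have lC : l < C m.+3 by apply: leq_trans l2 _; rewrite -(pos_end hr) pos_homo.
case: (leqP (pos m.+1 i) l) => pl.
  have [jC j1 j2] := blockP hr lC; set j := ht m.+2 l in jC j1 j2.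
  have Aj : A j.
    apply: (is_run_in h); rewrite -(pos_le hr) ?pl -?(ltn_pos hr) ?l2 //.
    by apply: leq_trans (ltnW ik) kC.
  case/andP: hg => /all0P/(_ _ jC); rewrite Aj /= => /all_rangeP H _.
  by apply: H; rewrite j1.
move: l1; rewrite /start; case: eqP => [et|_] l1; last by lia.
have [tk|[tk /has_rangeP[l' hl Tl']]] := rise_run h; first by lia.
suff -> : l = l' by [].
have iC : i.+1 <= C m.+2 by apply: leq_trans kC; rewrite -et.
have ec : climb m.+1 i = 1 by rewrite climbE ?et //= subnn.
by move: hl; rewrite ec; lia.
Qed.

Lemma supported_of l : supported D (beta_of T A) l = T l.
Proof.
apply/exists_inP/idP.
  move=> [[ik|e]]; rewrite inE /=; last by move=> /andP[Te _] /eqP->.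
  move=> h; have /and4P[ik12 _ _ _] := h.
  by rewrite in_alphaE // ?(is_run_le hA h) //; apply: run_T h.
move=> Tl; have lC := hT Tl; case hc : (covered A l).
  case/existsP: hc => ik /andP[h hl]; exists (inl ik); first by rewrite inE.
  by have /and4P[ik12 _ _ _] := h; rewrite /= in_alphaE // (is_run_le hA h).
by exists (inr (Ordinal lC)); rewrite ?inE /= ?Tl ?hc.
Qed.

Lemma in_runs_of j : in_runs (beta_of T A) j = A j.
Proof.
apply/existsP/idP => [[ik]|Aj].
  by rewrite has_alpha_of => /andP[h hj]; apply: (is_run_in h).
have [i [k [h hj]]] := is_run_exists hA Aj.
have [ik [e1 e2]] := run_ends h.
by exists ik; rewrite has_alpha_of e1 e2 h.
Qed.

Lemma ends_eq (ik jl : ends) : (ik.1 : nat, ik.2 : nat) = (jl.1 : nat, jl.2 : nat) -> ik = jl.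
Proof. by case: ik jl => i k [j l] /= [/val_inj-> /val_inj->]. Qed.

Lemma beta_of_FD : beta_of T A \in FD r m.+4 D.
Proof.
rewrite inE; apply/and4P; split.
- apply/subsetP => -[ik|e]; rewrite !inE //.
  by case/and4P.
- apply/forall_inP => p pb; apply/forall_inP => q qb; apply/implyP => ne.
  apply/forallP => l; apply/negP => /andP[pl ql].
  have dis (ik jl : ends) : is_run A ik.1 ik.2 -> is_run A jl.1 jl.2 -> ik != jl ->
      start ik.1 <= l < pos m.+1 ik.2 -> start jl.1 <= l < pos m.+1 jl.2 -> False.
    move=> h h' nn /andP[a1 a2] /andP[b1 b2].
    case: (is_run_sep h h') => [/ends_eq e|lt|lt]; first by rewrite e eqxx in nn.
      by have := start_ge lt; lia.
    by have := start_ge lt; lia.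
  have inr_dis (e : 'I_(C m.+4.-1)) (ik : ends) : inr e \in beta_of T A -> is_run A ik.1 ik.2 ->
      start ik.1 <= e < pos m.+1 ik.2 -> False.
    rewrite inE => /andP[_ /negP nc] h hl; apply: nc; apply/existsP; exists ik.
    by rewrite h.
  have alphaE (ik : ends) : inl ik \in beta_of T A -> is_run A ik.1 ik.2 /\
     (in_alpha r m.+4 D ik.1 ik.2 l = (start ik.1 <= l < pos m.+1 ik.2)).
    rewrite inE => h; split=> //; have /and4P[ik12 _ _ _] := h.
    by rewrite in_alphaE // (is_run_le hA h).
  case: p q pb qb ne pl ql => [ik|e] [jl|e'] pb qb ne /=.
  + have [h ->] := alphaE _ pb; have [h' ->] := alphaE _ qb.
    by apply: dis => //; apply: contraNneq ne => ->.
  + have [h ->] := alphaE _ pb => hl /eqP el; apply: (inr_dis e' ik) => //.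
    by rewrite -el.
  + have [h ->] := alphaE _ qb => /eqP el hl; apply: (inr_dis e jl) => //.
    by rewrite -el.
  + move=> /eqP e1 /eqP e2; case/eqP: ne; congr inr; apply: val_inj.
    by rewrite /= -e1 -e2.
- apply/forallP => ik; apply/forallP => jl; rewrite !has_alpha_of; apply/implyP => /andP[h h'].
  have /and4P[l1 _ _ n1] := h; have /and4P[l2 _ _ n2] := h'.
  apply/andP; split; apply/negP => /eqP e.
    move/negP: n2; apply; have -> : jl.2 = ik.1 :> nat by rewrite e.
    by apply: (is_run_in h); rewrite leqnn l1.
  move/negP: n1; apply; have -> : ik.2 = jl.1 :> nat by rewrite e.
  by apply: (is_run_in h'); rewrite leqnn l2.
apply/forallP => ik; apply/forallP => mu; apply/forallP => w; rewrite has_alpha_of.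
apply/implyP => /andP[h hG]; have kC := is_run_le hA h; have /and4P[ik12 _ _ _] := h.
have [tk ec _] := mw_green_rise hr ik12 kC hG.
have [lt|[_ /has_rangeP[l hl Tl]]] := rise_run h; first by lia.
apply/existsP; exists (Ordinal (hT Tl)); rewrite supported_of Tl andbT /= -ec vpos_Dmax //.
by apply: leq_trans (ltnW ik12) kC.
Qed.

End ToBeta.

Lemma beta_of_beta (beta : {set lab}) : beta \in FD r m.+4 D ->
  beta_of (supp beta) (in_runs beta) = beta.
Proof.
move=> hb; have hA := @in_runs_lt beta.
have run_of ik : has_alpha beta ik -> is_run (in_runs beta) ik.1 ik.2.
  move=> h; apply/and4P; split; [exact: beta_lt h| | |exact: in_runs_after h].
    by apply/all_rangeP => j hj; apply: in_runs_alpha h hj.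
  by case: posnP => //= i0; apply: in_runs_before.
have of_run (ik : ends) : is_run (in_runs beta) ik.1 ik.2 -> has_alpha beta ik.
  move=> h; have /and4P[ik12 _ _ _] := h.
  have : in_runs beta ik.1 by apply: (is_run_in h); lia.
  move=> /existsP[jl /and3P[h' j1 j2]].
  have [e1 e2] := is_run_uniq (j := ik.1) h (run_of _ h') ltac:(lia) ltac:(lia).
  by rewrite (_ : ik = jl) //; apply: ends_eq; rewrite e1 e2.
apply/setP => -[ik|e]; rewrite inE.
  by apply/idP/idP => [/of_run|/run_of].
apply/idP/idP.
  case/andP => /exists_inP[[ik|e'] pb pe] /negP nc; last first.
    by move: pb; rewrite /= in pe; rewrite (_ : e = e') //; apply/val_inj/eqP.
  case: nc; apply/existsP; exists ik; rewrite run_of //=.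
  by move: pe; rewrite /= in_alphaE ?(beta_lt hb pb) // ends_le.
move=> eb; apply/andP; split.
  by apply/exists_inP; exists (inr e) => /=.
apply/negP => /existsP[ik /andP[/of_run h he]].
suff : inr e = inl ik :> lab by [].
apply: (beta_disj hb eb h (l := e)) => //=.
by rewrite in_alphaE ?(beta_lt hb h) // ends_le.
Qed.

End Bijection.

(** * The sum over all collections of subpaths *)

Local Open Scope ring_scope.

Lemma nset_set n (P : pred nat) : (forall l, P l -> (l < n)%N) ->
  nset [set i : 'I_n | P i] =1 P.
Proof.
move=> hP l; case: (ltnP l n) => ln; first by rewrite -[l]/(val (Ordinal ln)) nsetE inE.
by rewrite (contraNF (@nset_lt _ _ _)) -?leqNgt //; apply/esym/(contraNF (hP l)); rewrite -leqNgt.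
Qed.

Lemma set_nset n (S : {set 'I_n}) (P : pred nat) : P =1 nset S -> [set i : 'I_n | P i] = S.
Proof. by move=> h; apply/setP => i; rewrite inE h nsetE. Qed.

Section Ext.
Variables (r m : nat).

Lemma eq_good T T' A A' : T =1 T' -> A =1 A' -> good r m T A = good r m T' A'.
Proof.
move=> eT eA; congr (_ && _); apply: eq_all => j.
  by rewrite eA; congr (_ ==> _); apply: eq_all.
by rewrite (eq_all eA) (eq_has eT).
Qed.

Lemma eq_is_run A A' i k : A =1 A' -> is_run A i k = is_run A' i k.
Proof. by move=> eA; rewrite /is_run (eq_all eA) !eA. Qed.

Lemma eq_beta_of T T' A A' : T =1 T' -> A =1 A' -> beta_of r m T A = beta_of r m T' A'.
Proof.
move=> eT eA; apply/setP => -[ik|e]; rewrite !inE; first exact: eq_is_run.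
rewrite eT; congr (_ && ~~ _); apply: eq_existsb => ik.
by rewrite (eq_is_run _ _ eA).
Qed.

Lemma eq_edge_wt (K : unitRingType) (x y : K) T T' A A' l : T =1 T' -> A =1 A' ->
  edge_wt r x y m T A l = edge_wt r x y m T' A' l.
Proof. by move=> eT eA; rewrite /edge_wt eT eA. Qed.
End Ext.

Section Weight.
Variables (r : nat) (k : fieldType) (K : unitAlgType k) (x y : K).
Hypothesis hr : (2 <= r)%N.
Hypotheses (uy : y \is a GRing.unit).
Variable m : nat.
Local Notation C := (c r).
Local Notation ht := (ht r).
Local Notation pos := (pos r).
Local Notation vert := (vert r).
Local Notation rise := (rise r).
Local Notation D := (Dmax r m).

Lemma vert_riseS j : vert m.+1 j -> (j.+1 <= C m.+2)%N -> rise m.+1 j = j.+1.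
Proof.
move=> v jC; apply: rise_eq => // [|i]; last by lia.
have := ht_depth r m.+1 j; have := ht_depth r m.+1 j.+1; have := c_mono hr m.
rewrite htS // v addn1 !mulSn; lia.
Qed.

Lemma vert_gt0 j : vert m.+1 j -> (0 < j)%N.
Proof. by case: j => // v; have := ht_lt hr m 0; move: v; rewrite /vert ht0; lia. Qed.

(** A vertical edge of a subpath whose (r-1)-st predecessor is horizontal
    closes a block of r edges; otherwise that predecessor is the vertical edge
    closing the preceding block, which belongs to the subpath even if the
    block is the first one, since the subpath is then red.  The first edge of
    a red subpath has no such predecessor in the subpath. *)
Lemma weight_edge_wt (beta : {set label r m.+4}) (l : 'I_(C m.+4.-1)) :
  beta \in FD r m.+4 D ->
  weight x y D beta l = edge_wt r x y m.+1 (supp beta) (in_runs beta) l.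
Proof.
move=> hb; have lC : (l < C m.+3)%N := ltn_ord l.
have vE p : (p < C m.+3)%N -> nth false D p = vert m.+2 p by move=> h; rewrite nth_mkseq.
have [jC j1 j2] := blockP hr lC; set j := ht m.+2 l in jC j1 j2.
have vl : vert m.+2 l = (l.+1 == pos m.+1 j.+1) by apply: vert_block.
rewrite /weight /edge_wt -/(supp beta l) (vE _ lC) -/j.
case hs : (supp beta l) => /=; last first.
  rewrite /wt_out; case: vert => /=; last by rewrite expr0 mulr1.
  by rewrite expr1 -mulrA -{2}(prednK (ltnW hr)) exprSr mulrK.
have in_alphaP ik p : has_alpha beta ik ->
    in_alpha r m.+4 D ik.1 ik.2 p = (start r m ik.1 <= p < pos m.+1 ik.2)%N.
  by move=> h; rewrite in_alphaE ?(beta_lt hb h) // ends_le.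
have block_in ik : has_alpha beta ik -> (ik.1 <= j < ik.2)%N ->
    (start r m ik.1 <= l < pos m.+1 ik.2)%N.
  move=> h /andP[i1 i2]; apply/andP; split.
    by apply: leq_trans j1; apply: leq_trans (start_le _ _ _) (pos_homo hr m i1).
  by apply: leq_trans j2 (pos_homo hr m i2).
case hi : ((inr l : label r m.+4) \in beta).
  have -> : in_runs beta j = false.
    apply/negbTE/negP => /in_runsP[ik h hj].
    suff : inr l = inl ik :> label r m.+4 by [].
    by apply: (beta_disj hb hi h lC) => //=; rewrite in_alphaP // block_in.
  by rewrite /= /wt_single; case: vert; rewrite /= ?expr1 ?expr0 ?mulr1.
have [ik h hl] : exists2 ik, has_alpha beta ik & (start r m ik.1 <= l < pos m.+1 ik.2)%N.
  case/exists_inP: hs => -[ik|e] pb /= pl; last first.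
    by move: hi; rewrite (_ : l = e) ?pb //; apply/val_inj/eqP.
  by exists ik => //; rewrite -in_alphaP.
have [h1 h2] := ends_le ik; have ik12 := beta_lt hb h.
have runj : (pos m.+1 ik.1 <= l)%N -> in_runs beta j.
  move=> il; apply: (in_runs_alpha h); rewrite -(pos_le hr) // il -(ltn_pos hr) //.
  by case/andP: hl.
case hv : (vert m.+2 l) => /=; last first.
  rewrite runj //=; rewrite leqNgt; apply/negP => li.
  have e1 : l.+1 = pos m.+1 ik.1.
    by case/andP: hl => hl _; case: (start_before hr hl li).
  by move: hv; rewrite /vert e1 ht_pos // -ltn_pos // li.
have el : l.+1 = pos m.+1 j.+1 by apply/eqP; rewrite -vl.
case hA : (in_runs beta j) => /=; last first.
  have li : (l < pos m.+1 ik.1)%N by rewrite ltnNge; apply/negP => /runj; rewrite hA.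
  have e1 : start r m ik.1 = l :> nat.
    by case/andP: hl => hl _; case: (start_before hr hl li).
  rewrite ifN; first by rewrite /wt_single expr1.
  apply/negP => /existsP[jl /and4P[h' g1 g2 g3]].
  have e : inl ik = inl jl :> label r m.+4.
    by apply: (beta_disj hb h h' lC) => //=; rewrite in_alphaP.
  case: e => ej; move: g3; rewrite -ej in_alphaP // e1 => /andP[g3 _].
  have r1 : (0 < r.-1)%N by clear -hr; lia.
  by move: g3; rewrite leqNgt ltn_subrL r1 (leq_trans r1 g2).
have [jl h' /andP[i1 i2]] := in_runsP hA.
have pS := posS hr m j; rewrite -el in pS.
have rl : (r.-1 <= l)%N.
  case hvj : (vert m.+1 j) pS => pS; last by move: pS; clear; lia.
  by move: pS (leq_idpos hr m j) (vert_gt0 hvj); clear; lia.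
have inl' : in_alpha r m.+4 D jl.1 jl.2 (l - r.-1).
  rewrite in_alphaP //; apply/andP; split; last first.
    have := block_in _ h'; rewrite i1 i2 => /(_ isT)/andP[_].
    by apply: leq_ltn_trans; apply: leq_subr.
  case hvj : (vert m.+1 j) pS => pS; last first.
    have -> : (l - r.-1 = pos m.+1 j)%N by move: pS; clear -hr; lia.
    exact: leq_trans (start_le _ _ _) (pos_homo hr m i1).
  have j0 := vert_gt0 hvj.
  have -> : (l - r.-1 = (pos m.+1 j).-1)%N by move: pS; clear -hr; lia.
  move: i1; rewrite leq_eqVlt => /orP[/eqP e|lt].
    by rewrite e /start (vert_riseS hvj jC) eqxx subn1.
  by apply: leq_trans (start_le _ _ _) _; rewrite -ltnS prednK ?pos_lt //; apply: leq_trans (leq_idpos hr m j).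
rewrite ifT; last first.
  apply/existsP; exists jl; apply/and4P; split=> //; rewrite in_alphaP //.
  by apply: block_in; rewrite ?i1.
rewrite vE; last by apply: leq_ltn_trans lC; apply: leq_subr.
rewrite /rho; case hvj : (vert m.+1 j) pS => pS.
  have j0 := vert_gt0 hvj.
  have -> : (l - r.-1 = (pos m.+1 j.-1.+1).-1)%N.
    by rewrite (prednK j0); move: pS; clear -hr; lia.
  have jC' : (j.-1 < C m.+2)%N by apply: leq_ltn_trans (leq_pred _) jC.
  by have [-> _] := vert_last hr jC'; rewrite expr1.
have -> : (l - r.-1 = pos m.+1 j)%N by move: pS; clear -hr; lia.
have [|-> _] := @vert_low r hr m j (pos m.+1 j) jC; last by rewrite expr0 mul1r.
rewrite leqnn -el andTb; move: pS; rewrite addn0 /=; clear -hr; lia.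
Qed.

Lemma sum_beta :
  \sum_(beta in FD r m.+4 D) \prod_(i < C m.+4.-1) weight x y D beta i = path_sum r x y m.
Proof.
rewrite /path_sum pair_big_dep /=.
pose g (TA : {set 'I_(C m.+3)} * {set 'I_(C m.+2)}) := beta_of r m (nset TA.1) (nset TA.2).
pose f (beta : {set label r m.+4}) : {set 'I_(C m.+3)} * {set 'I_(C m.+2)} :=
  ([set l : 'I_(C m.+3) | supp beta l], [set j : 'I_(C m.+2) | in_runs beta j]).
have fT beta : beta \in FD r m.+4 D -> nset (f beta).1 =1 supp beta.
  by move=> hb; apply: nset_set => l; apply: supp_lt.
have fA beta : nset (f beta).2 =1 in_runs beta by apply: nset_set => l; apply: in_runs_lt.
rewrite (reindex_onto g f) => [|beta hb]; last first.
  by rewrite -[RHS](beta_of_beta hr hb); apply: eq_beta_of; [apply: fT|apply: fA].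
have goodE TA : good r m.+1 (nset TA.1) (nset TA.2) ->
    supp (g TA) =1 nset TA.1 /\ in_runs (g TA) =1 nset TA.2.
  move=> hg; split=> l.
    exact: (supported_of hr (@nset_lt _ TA.1) (@nset_lt _ TA.2) hg).
  exact: (in_runs_of hr (@nset_lt _ TA.2) hg).
apply: eq_big => [TA|TA].
  apply/andP/idP => [[hb /eqP e]|hg].
    have := good_beta hr hb; rewrite (@eq_good _ _ _ (nset TA.1) _ (nset TA.2)) // => l.
      by rewrite -fT // e.
    by rewrite -fA e.
  have [e1 e2] := goodE _ hg.
  split; first exact: (beta_of_FD hr (@nset_lt _ TA.1) (@nset_lt _ TA.2) hg).
  by apply/eqP; case: TA e1 e2 {hg} => T A e1 e2; rewrite /f (set_nset e1) (set_nset e2).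
move=> /andP[hb /eqP e]; rewrite big_mkord; apply: eq_bigr => l _.
rewrite weight_edge_wt //; apply: eq_edge_wt => i; first by rewrite -fT // e.
by rewrite -fA e.
Qed.

End Weight.

(** * Iterating the automorphism *)

Section Final.
Variables (k : fieldType) (K : unitAlgType k) (x y : K).

(** Specialize x and y to 1. *)
Lemma free_gen_neq0 : free_skew_field x y -> x != 0 /\ y != 0.
Proof.
move=> [hS _ hspec].
have [S [f [[hC f1 fl _ _] [xS yS] fx fy]]] := hspec K 1 1 hS.
have [S1 _ _] := hC.
have f0 : f 0 = 0.
  have := fl (-1) 1 1 S1 S1; rewrite !scaleN1r f1 !addNr //.
by split; apply/eqP => e; [move: fx|move: fy]; rewrite e f0 => /esym/eqP; rewrite oner_eq0.
Qed.

Variables (r : nat) (F : {rmorphism K -> K}).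
Hypotheses (hr : (2 <= r)%N) (ux : x \is a GRing.unit) (uy : y \is a GRing.unit).
Local Notation q := (1 + y ^+ r).
Hypothesis uq : q \is a GRing.unit.
Hypotheses (Fx : F x = x * y * x^-1) (Fy : F y = q * x^-1).
Local Notation kappa := (x * y * x^-1 * y^-1).

(** The automorphism Phi of [path_sum_step].  As F fixes the commutator kappa,
    it maps kappa x u x^-1 to kappa x Phi(u) x^-1 ([F_step]). *)
Definition conjF (u : K) : K := y * x^-1 * F u * x * y^-1.

Lemma conjF_additive : zmod_morphism conjF.
Proof. by move=> u v; rewrite /conjF rmorphB mulrBr !mulrBl. Qed.

Lemma conjF_monoid : monoid_morphism conjF.
Proof.
split=> [|u v]; first by rewrite /conjF rmorph1 mulr1 divrK // divrr.
by rewrite /conjF rmorphM !mulrA divrK // mulrK.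
Qed.

HB.instance Definition _ := GRing.isZmodMorphism.Build K K conjF conjF_additive.
HB.instance Definition _ := GRing.isMonoidMorphism.Build K K conjF conjF_monoid.

Lemma conjFx : conjF x = y.
Proof. by rewrite /conjF Fx !mulrA !divrK // mulrK. Qed.

Lemma conjFy : conjF y = y * (x^-1 * q) * y^-1.
Proof. by rewrite /conjF Fy !mulrA divrK. Qed.

Lemma F_xV : F x^-1 = x * y^-1 * x^-1.
Proof.
rewrite rmorphV // Fx invrM ?unitrV //; last by rewrite unitrMl.
by rewrite invrK invrM // mulrA.
Qed.

Lemma q_yV : q * y^-1 = y^-1 * q.
Proof. by have := comm_q r y 1; rewrite /GRing.comm expr1. Qed.

Lemma F_kappa : F kappa = kappa.
Proof.
rewrite !rmorphM F_xV (rmorphV _ uy) Fx Fy invrM ?unitrV // invrK.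
rewrite !mulrA !divrK //.
by rewrite -(mulrA _ q y^-1) q_yV !mulrA mulrK.
Qed.

Lemma F_step u : F (kappa * x * u * x^-1) = kappa * x * conjF u * x^-1.
Proof.
have -> : F (kappa * x * u * x^-1) = F kappa * F x * F u * F x^-1 by rewrite !rmorphM.
by rewrite F_kappa F_xV Fx /conjF !mulrA.
Qed.

Lemma iter2 : iter 2 F x = kappa * x * (x^-1 * q) * x^-1.
Proof.
rewrite /= Fx !rmorphM F_xV Fx Fy !mulrA !divrK // mulrK //.
by rewrite -(mulrA _ q y^-1) q_yV !mulrA.
Qed.

Lemma iterF m : iter m.+3 F x = kappa * x * path_sum r x y m * x^-1.
Proof.
elim: m => [|m IH].
  rewrite (path_sum_base hr ux uy uq (Phi := conjF)); [|exact: conjFx|exact: conjFy].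
  by rewrite iterS iter2 F_step.
by rewrite iterS IH F_step (path_sum_step hr ux uy uq (Phi := conjF) conjFx conjFy).
Qed.

End Final.

Theorem theorem11 (k : fieldType) (hk : [pchar k] =i pred0)
    (K : unitAlgType k) (x y : K) (hK : free_skew_field x y)
    (r : nat) (hr : (2 <= r)%N)
    (F : {rmorphism K -> K}) (hF : is_Fr x y r F)
    (n : nat) (hn : (4 <= n)%N)
    (D : seq bool) (hD : is_Dn r n D) :
  iter n.-1 F x =
    \sum_(beta in FD r n D)
      x * y * x^-1 * y^-1 * x *
      (\prod_(i < c r n.-1) weight x y D beta i) * x^-1.
Proof.
have [x0 y0] := free_gen_neq0 hK; have [hS _ _] := hK.
have [ux uy] := (hS _ x0, hS _ y0).
have [Fbij _ Fx Fy] := hF.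
have uq : 1 + y ^+ r \is a GRing.unit.
  apply: hS; apply: contra_neq y0 => q0; apply: (bij_inj Fbij).
  by rewrite Fy q0 mul0r rmorph0.
case: n hn hD => [|[|[|[|m]]]] // _ hD.
rewrite (maximal_Dmax hr hD) -mulr_suml -mulr_sumr sum_beta //.
exact: iterF.
Qed.
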